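(* Let $E$ be a countable Borel equivalence relation on a standard Borel space $X$, and let $G$ be a locally-finite graphing of $E$. Suppose that for each connected component $C\subseteq X$ of $G$ there is given a finitely-separating pocset $\mathcal{H}(C)\subseteq 2^C$ of cuts in the connected graph $G|C$ that is dense towards ends of $G|C$, and suppose that $\mathcal{H}:=\bigsqcup_C\mathcal{H}(C)$ is a Borel subset of the standard Borel space of all cuts of $G$. Then $E$ is treeable.
   Context: A countable Borel equivalence relation is a Borel equivalence relation $E\subseteq X^2$ with all classes countable. A graph on $X$ is a symmetric irreflexive $G\subseteq X^2$; it is locally-finite if each vertex has finitely many neighbours. A graphing of $E$ is a Borel graph $G\subseteq X^2$ whose connectedness relation is exactly $E$; $G|C$ is the induced graph on a component ($E$-class) $C$. A treeing of $E$ is a graphing with every component a tree; $E$ is treeable if it has a treeing. Let $(C,G)$ be a connected locally-finite graph. For $A\subseteq C$ let $\neg A=C\setminus A$, let $\partial_{\mathsf{iv}}A$ be the set of points of $A$ with a neighbour in $\neg A$, $\partial_{\mathsf{ov}}A=\partial_{\mathsf{iv}}(\neg A)$, $\partial_{\mathsf{v}}A=\partial_{\mathsf{iv}}A\cup\partial_{\mathsf{ov}}A$, and $\partial_{\mathsf{ie}}A=G\cap(\partial_{\mathsf{ov}}A\times\partial_{\mathsf{iv}}A)$. $\mathcal{H}_{\partial<\infty}(C)$ is the Boolean algebra of all $A\subseteq C$ with $\partial_{\mathsf{v}}A$ finite. A cut is an $H\in\mathcal{H}_{\partial<\infty}(C)$ such that $H$ and $\neg H$ are both connected ($\emptyset$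 counts as connected). A pocset of cuts is a family of cuts containing $\emptyset$ and closed under complement. It is finitely-separating if for all $x,y\in C$ only finitely many members $H$ satisfy $x\in H\not\ni y$. An end of $(C,G)$ is a non-principal ultrafilter $p$ on $\mathcal{H}_{\partial<\infty}(C)$. A family $\mathcal{H}(C)$ is dense towards ends if for every end $p$ and every $A\in p$ there is $H\in\mathcal{H}(C)$ with $H\in p$ and $H\subseteq A$. The standard Borel space of all cuts of $G$: a non-trivial cut ($H\ne\emptyset,C$) in a component $C$ is encoded by its finite non-empty inward edge boundary $\partial_{\mathsf{ie}}H\in[G]^{<\infty}$, which determines it; under this encoding the set of all non-trivial cuts of all components is a Borel subset of the standard Borel space $[G]^{<\infty}$ of finite subsets of $G$. That $\mathcal{H}$ is Borel means that the set of codes of the non-trivial members of all the $\mathcal{H}(C)$ is Borel. *)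

(* Defs.v *)
From mathcomp Require Import all_boot all_order all_algebra.
From mathcomp Require Import all_classical all_reals all_analysis.

Set Implicit Arguments.
Unset Strict Implicit.
Unset Printing Implicit Defensive.

Local Open Scope classical_set_scope.

Definition separable_space (M : topologicalType) : Prop :=
  exists2 D : set M, countable D & dense D.

Definition complete_space (M : uniformType) : Prop :=
  forall F : set_system M, ProperFilter F -> cauchy F -> exists x : M, F --> x.

(* [f] transports the Borel sets of a Polish metric space to [X]; going through
   a bijection avoids equating the carriers of two structures. *)
Definition standard_borel (R : realType) (d : measure_display)
    (X : measurableType d) : Prop :=
  exists (M : metricType R) (f : X -> M),
    [/\ bijective f, separable_space M, complete_space M &
        @measurable d X = [set f @^-1` B | B in <<s @open M >>]].

(* The Borel subsets of the space of finite subsets of a measurable set [G]: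
   its Borel structure is the quotient, by [t |-> {t_0, ..., t_(n-1)}], of the
   disjoint union of the powers of [G].  As [G] is measurable, measurability in
   the power of [G] is measurability in the power of the ambient type. *)
Definition borel_finsubsets (d : measure_display) (T : measurableType d)
    (G : set T) (F : set (set T)) : Prop :=
  F `<=` [set s | finite_set s /\ s `<=` G] /\
  forall n : nat, measurable [set t : n.-tuple T | F [set` t]].

(* Graphs are given by their set of ordered edges *)

Section Graphs.
Variable T : choiceType.
Implicit Types (G E : set (T * T)) (A C H : set T) (S p : set (set T)).

Definition is_graph G : Prop :=
  (forall x y, G (x, y) -> G (y, x)) /\ (forall x, ~ G (x, x)).

Definition locally_finite G : Prop := forall x, finite_set (xsection G x).

Definition adj G : rel T := [rel x y | (x, y) \in G].

Definition connectedness G : set (T * T) :=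
  [set xy | exists2 s : seq T, path (adj G) xy.1 s & last xy.1 s = xy.2].

Definition induced_graph G A : set (T * T) := G `&` (A `*` A).

Definition connected_on G A : Prop := A `*` A `<=` connectedness (induced_graph G A).

Definition components G : set (set T) := range (xsection (connectedness G)).

Definition acyclic G : Prop :=
  forall s : seq T, (3 <= size s)%N -> ~ ucycle (adj G) s.

Definition is_tree G C : Prop :=
  [/\ C !=set0, connected_on G C & acyclic (induced_graph G C)].

(* Boundaries are taken in the graph with vertex set [C] and edge set [G] *)

Definition inner_vbd C G A : set T :=
  [set x | A x /\ exists2 y, (C `\` A) y & G (x, y)].

Definition outer_vbd C G A : set T := inner_vbd C G (C `\` A).

Definition vbd C G A : set T := inner_vbd C G A `|` outer_vbd C G A.

Definition inward_ebd C G A : set (T * T) :=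
  G `&` (outer_vbd C G A `*` inner_vbd C G A).

Definition finite_vbd_algebra C G : set (set T) :=
  [set A | A `<=` C /\ finite_set (vbd C G A)].

Definition is_cut C G H : Prop :=
  [/\ finite_vbd_algebra C G H, connected_on G H & connected_on G (C `\` H)].

Definition cut_pocset C G S : Prop :=
  [/\ S `<=` is_cut C G, S set0 & forall H, S H -> S (C `\` H)].

Definition finitely_separating C S : Prop :=
  forall x y, C x -> C y -> finite_set [set H | [/\ S H, H x & ~ H y]].

(* The library's [UltraFilter] is about the full powerset; here [B] is a Boolean
   algebra of subsets of [C], with complement taken in [C]. *)
Record ultrafilter_on C (B : set (set T)) p : Prop := UltrafilterOn {
  uf_sub : p `<=` B ;
  uf_top : p C ;
  uf_proper : ~ p set0 ;
  uf_meet : forall A A', p A -> p A' -> p (A `&` A') ;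
  uf_up : forall A A', p A -> B A' -> A `<=` A' -> p A' ;
  uf_ultra : forall A, B A -> p A \/ p (C `\` A)
}.

Definition principal_in (B : set (set T)) p : Prop :=
  exists2 A0, B A0 & p = [set A | B A /\ A0 `<=` A].

Definition is_end C G p : Prop :=
  ultrafilter_on C (finite_vbd_algebra C G) p /\
  ~ principal_in (finite_vbd_algebra C G) p.

Definition dense_towards_ends C G S : Prop :=
  forall p, is_end C G p -> forall A, p A ->
    exists H, [/\ S H, p H & H `<=` A].

(* The codes of the non-trivial members of the family [HH], where [HH C]
   consists of cuts of the component [C]; [HH] is irrelevant elsewhere. *)
Definition cut_codes G (HH : set T -> set (set T)) : set (set (T * T)) :=
  [set F | exists C H, [/\ components G C, HH C H, H <> set0, H <> C &
                           F = inward_ebd C (induced_graph G C) H]].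

End Graphs.

Section BorelEquivalence.
Context {d : measure_display} {X : measurableType d}.
Implicit Types E G : set (X * X).

Definition is_equivalence E : Prop :=
  [/\ forall x, E (x, x), forall x y, E (x, y) -> E (y, x) &
      forall x y z, E (x, y) -> E (y, z) -> E (x, z)].

Definition countable_borel_equivalence E : Prop :=
  [/\ is_equivalence E, measurable E & forall x, countable (xsection E x)].

Definition graphing E G : Prop :=
  [/\ is_graph G, measurable G & connectedness G = E].

Definition treeing E G : Prop :=
  graphing E G /\ forall C, components G C -> is_tree G C.

Definition treeable E : Prop := exists G, treeing E G.

End BorelEquivalence.

(* Main.v *)
Require Import Defs.
From mathcomp Require Import all_boot all_order all_algebra.
From mathcomp Require Import all_classical all_reals all_analysis.
From mathcomp Require Import lra.

(* Let C be a component.  Two cuts cross only if the second one separates two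
   boundary vertices of the first, so each wall crosses finitely many others.  A
   chain of cuts descending to an end shows that only finitely many points of C
   are separated from a given one by at most m walls.

   The median graph of C has as vertices the orientations of all walls that are
   at finite distance from those given by points of C; its edges reverse one
   wall.  Colour the walls by natural numbers so that crossing walls get
   different colours.  After deleting all hyperplanes of colour larger than n,
   keep one edge of each remaining hyperplane of colour n in each component.
   As walls of colour n are nested, both ends of such a hyperplane lie in one
   component for the colours below n, so by induction on n the edges kept form a
   spanning tree.  Sending each vertex to the nearest point of C in this tree
   (with ties broken by a Borel linear order) contracts the tree to one on C.

   Every choice above is definable with countable quantifiers from the Borel
   data, once the connectedness relation is enumerated by countably many Borel
   functions.  Such functions exist by the Lusin-Novikov theorem for finite
   sections, which follows from Novikov's separation theorem for countable
   families of analytic sets. *)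

Set Implicit Arguments.
Unset Strict Implicit.
Unset Printing Implicit Defensive.
Import Order.TTheory GRing.Theory Num.Theory.
Local Open Scope classical_set_scope.

(** * Borel and analytic subsets of Cantor space *)

(** Cuts may cross, so the pocset itself need not carry a tree, which is why one passes to the
    median graph. The obstacle is uniformity: every selection has to depend on a wall and a
    component only, not on the vertex from which it is viewed. A wall has a finite boundary, so its
    least boundary vertex in a Borel linear order is a canonical base point, and enumerations are
    made from there. The same base points give the colouring: a finite approximation of the base
    point, with a code relative to it, tells a wall apart from the finitely many that cross it. The
    finiteness drawn from density makes a ball of the tree reach finitely many points of C, so a
    least nearest point exists although the order is not a well-order. Median vertices are never
    assembled into a Borel space; they are named from points of X by finite lists of codes. *)

Notation cantor := (nat -> bool).

Inductive borel : set cantor -> Prop :=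
| borel_bit i : borel [set z | z i]
| borelC A : borel A -> borel (~` A)
| borel_bigcup (A : nat -> set cantor) :
    (forall n, borel (A n)) -> borel (\bigcup_n A n).

Lemma borel_ext A B : A =1 B -> borel A -> borel B.
Proof. by move=> /funext ->. Qed.

Lemma borel_exists (I : countType) (A : I -> set cantor) :
  (forall i, borel (A i)) -> borel [set z | exists i, A i z].
Proof.
move=> bA; have b0 : borel set0.
  (* No constructor gives the empty set: it is the complement of a set joined with its own
     complement. *)
  apply: (@borel_ext (~` \bigcup_n (if n is 0%N then [set z | z 0%N] else ~` [set z | z 0%N]))).
    move=> z; apply/propext; split=> //; apply.
    by have [z0|z0] := pselect (z 0%N); [exists 0%N|exists 1%N].
  by apply/borelC/borel_bigcup => -[|n]; [|apply: borelC]; exact: borel_bit.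
rewrite (_ : mkset _ = \bigcup_n (if unpickle n is Some i then A i else set0)).
  by apply: borel_bigcup => n; case: unpickle.
apply/seteqP; split=> z [i].
  by exists (pickle i); rewrite ?pickleK.
by move=> _; case: unpickle => // j ?; exists j.
Qed.

Lemma borel_forall (I : countType) (A : I -> set cantor) :
  (forall i, borel (A i)) -> borel [set z | forall i, A i z].
Proof.
move=> bA; rewrite (_ : mkset _ = ~` [set z | exists i, (~` A i) z]).
  by apply/borelC/borel_exists => i; exact/borelC/bA.
apply/seteqP; split=> z /= Az; first by case=> i; exact.
by move=> i; apply: contrapT => nA; apply: Az; exists i.
Qed.

Lemma borelU A B : borel A -> borel B -> borel (A `|` B).
Proof.
move=> bA bB; apply: (@borel_ext [set z | exists b : bool, (if b then A else B) z]).
  move=> z; apply/propext; split=> [[[]]|[]]; [left|right|exists true|exists false] => //.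
by apply: borel_exists => -[].
Qed.

Lemma borelI A B : borel A -> borel B -> borel (A `&` B).
Proof.
move=> bA bB; rewrite -[A `&` B]setCK setCI.
by apply/borelC/borelU; exact/borelC.
Qed.

Lemma borel_cst (P : Prop) : borel [set _ | P].
Proof.
have [p|p] := pselect P.
  apply: (@borel_ext [set z | forall i : void, True]).
    by move=> z; apply/propext.
  by apply: borel_forall => -[].
apply: (@borel_ext [set z | exists i : void, True]).
  by move=> z; apply/propext; split=> // -[[]].
by apply: borel_exists => -[].
Qed.

Lemma borel_imply A B : borel A -> borel B -> borel [set z | A z -> B z].
Proof.
move=> bA bB; apply: (@borel_ext (~` A `|` B)); last exact/borelU/bB/borelC.
move=> z; apply/propext; split=> [[nA Az|Bz _]|AB]; [by case: nA|by []|].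
by have [/AB|] := pselect (A z); [right|left].
Qed.

Lemma borel_preimage (f : cantor -> cantor) (B : set cantor) :
  (forall i, borel [set z | f z i]) -> borel B -> borel (f @^-1` B).
Proof.
move=> bf; elim=> [i|A _ bA|A _ bA]; first exact: bf.
- by rewrite preimage_setC; exact: borelC.
- by rewrite preimage_bigcup; exact: borel_bigcup.
Qed.

Definition agree (T : Type) N (a b : nat -> T) := forall i, (i < N)%N -> a i = b i.

Lemma agree_le (T : Type) M N (a b : nat -> T) : (M <= N)%N -> agree N a b -> agree M a b.
Proof. by move=> MN ab i iM; apply: ab; exact: leq_trans MN. Qed.

(** Continuity of precomposition with [f]: the first [N] values involve finitely many positions. *)
Lemma agree_comp (T : Type) (f : nat -> nat) N :
  exists M, forall a b : nat -> T, agree M a b -> agree N (a \o f) (b \o f).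
Proof.
exists (\max_(i < N) (f i).+1)%N => a b ab i iN; apply: ab.
exact: (leq_bigmax (Ordinal iN)).
Qed.

Lemma borel_agree N b : borel [set z | agree N z b].
Proof.
apply: (@borel_ext [set z | forall i : 'I_N, z i = b i]).
  move=> z; apply/propext; split=> [zb i iN|zb i]; last exact: zb.
  exact: (zb (Ordinal iN)).
apply: borel_forall => i; case: (b i); first exact: borel_bit.
apply: (@borel_ext (~` [set z | z i])); last exact/borelC/borel_bit.
by move=> z /=; apply/propext; split => [/negP/negbTE|->].
Qed.

(* Closed subsets of Baire space times Cantor space; [analytic] sets are their
   projections. *)
Definition closed_rel (F : (nat -> nat) -> set cantor) := forall a z, ~ F a z ->
  exists N, forall b w, agree N a b -> agree N z w -> ~ F b w.

Definition analytic (A : set cantor) :=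
  exists2 F, closed_rel F & A = [set z | exists a, F a z].

(** Digit 0 of a witness selects the index of the union; the remaining digits witness membership. *)
Lemma analytic_bigcup (A : nat -> set cantor) :
  (forall n, analytic (A n)) -> analytic (\bigcup_n A n).
Proof.
move=> /(_ _)/cid2-/all_sig2[F Fc AE].
exists (fun a => F (a 0%N) (a \o succn)).
  move=> a z /Fc[N FN]; exists N.+1 => b w ab zw.
  rewrite -ab//; apply: FN => [i iN|]; last exact: agree_le zw.
  exact: ab.
apply/seteqP; split=> z.
  by case=> n _; rewrite AE => -[a Fa]; exists (fun i => if i is j.+1 then a j else n).
by case=> a Fa; exists (a 0%N) => //; rewrite AE; exists (a \o succn).
Qed.

(** One point of Baire space carries witnesses for all [n] at once, through the pairing of
    [(n, i)]. *)
Lemma analytic_bigcap (A : nat -> set cantor) :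
  (forall n, analytic (A n)) -> analytic (\bigcap_n A n).
Proof.
move=> /(_ _)/cid2-/all_sig2[F Fc AE].
exists (fun a z => forall n, F n (a \o (fun i => pickle (n, i))) z).
  move=> a z /existsNP[n /Fc[N FN]].
  have [M MN] := @agree_comp nat (fun i => pickle (n, i)) N.
  exists (maxn M N) => b w ab zw /(_ n); apply: FN.
    by apply: MN; apply: agree_le ab; rewrite leq_maxl.
  by apply: agree_le zw; rewrite leq_maxr.
apply/seteqP; split=> z Az.
  have /(_ _)/cid-/all_sig[a Fa] : forall n, exists a, F n a z.
    by move=> n; have := Az n Logic.I; rewrite AE.
  exists (fun k => if unpickle k is Some (n, i) then a n i else 0%N) => n.
  rewrite (_ : _ \o _ = a n)//.
  by apply/funext => i /=; rewrite pickleK.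
by case: Az => a Fa n _; rewrite AE; exists (a \o (fun i => pickle (n, i))).
Qed.

(** Analyticity does not pass to complements, so the induction carries the complement along. *)
Lemma borel_analytic A : borel A -> analytic A.
Proof.
move=> bA; suff [] : analytic A /\ analytic (~` A) by [].
elim: bA => {A} [i|A _ []|A _ AA].
- split.
    exists (fun _ z => z i) => [a z nz|].
      by exists i.+1 => b w _ <-.
    by apply/seteqP; split=> z /=; [exists id | case].
  exists (fun _ z => ~ z i) => [a z nz|].
    by exists i.+1 => b w _ <-.
  by apply/seteqP; split=> z /=; [exists id | case].
- by split; rewrite ?setCK.
- split; first by apply: analytic_bigcup => n; case: (AA n).
  by rewrite setC_bigcup; apply: analytic_bigcap => n; case: (AA n).
Qed.

Lemma analyticU A B : analytic A -> analytic B -> analytic (A `|` B).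
Proof.
move=> aA aB; rewrite (_ : _ `|` _ = \bigcup_n if n is 0%N then A else B).
  by apply: analytic_bigcup => -[].
apply/seteqP; split=> z; last by case=> -[|n] _; [left|right].
by case; [exists 0%N|exists 1%N].
Qed.

Lemma analyticI A B : analytic A -> analytic B -> analytic (A `&` B).
Proof.
move=> aA aB; rewrite (_ : _ `&` _ = \bigcap_n if n is 0%N then A else B).
  by apply: analytic_bigcap => -[].
apply/seteqP; split=> z; first by case=> ? ? [].
by move=> ABz; split; [exact: (ABz 0%N)|exact: (ABz 1%N)].
Qed.

(* [pr] interleaves two points; [prl] and [prr] are its inverses. *)
Definition pr (z w : cantor) : cantor := fun n => if odd n then w n./2 else z n./2.
Definition prl (z : cantor) : cantor := fun n => z n.*2.
Definition prr (z : cantor) : cantor := fun n => z n.*2.+1.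

Lemma prlK z w : prl (pr z w) = z.
Proof. by apply/funext => n; rewrite /prl /pr odd_double doubleK. Qed.

Lemma prrK z w : prr (pr z w) = w.
Proof. by apply/funext => n; rewrite /prr /pr /= odd_double/= uphalf_double. Qed.

(** Odd digits keep the old witness; even digits, read as zero or nonzero, supply the projected
    coordinate. *)
Lemma analytic_proj A : analytic A -> analytic [set z | exists w, A (pr z w)].
Proof.
move=> [F Fc ->].
exists (fun a z => F (a \o (fun i => i.*2.+1)) (pr z (fun i => a i.*2 != 0%N))).
  move=> a z /Fc[N FN].
  have [M MN] := @agree_comp nat (fun i => i.*2.+1) N.
  have [M' M'N] := @agree_comp nat double N.
  exists (maxn N (maxn M M')) => b w ab zw; apply: FN.
    by apply: MN; apply: agree_le ab; rewrite !leq_max leqnn orbT.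
  have {}ab := M'N _ _ (agree_le _ ab).
  have iN i : (i < N -> i./2 < N)%N by apply: leq_ltn_trans; rewrite -divn2 leq_div.
  move=> i /iN {}iN; rewrite /pr; case: ifP => _.
    have /= -> // : (a \o double) i./2 = (b \o double) i./2.
    by apply: ab => //; rewrite !leq_max leqnn !orbT.
  by apply: zw; rewrite (leq_trans iN)// leq_maxl.
apply/seteqP; split=> z /=.
  case=> w [a Fa].
  exists (fun n => if odd n then a n./2 else nat_of_bool (w n./2)).
  congr (F _ (pr _ _)): Fa; apply/funext => i /=.
    by rewrite odd_double/= uphalf_double.
  by rewrite odd_double doubleK; case: (w i).
by case=> a Fa; exists (fun i => a i.*2 != 0%N), (a \o (fun i => i.*2.+1)).
Qed.

Definition separated (A : nat -> set cantor) := exists B : nat -> set cantor,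
  [/\ forall n, borel (B n), forall n, A n `<=` B n & forall z, ~ forall n, B n z].

(* If no Borel sets separated the family, one could fix the digits of all the
   witnesses one after the other, keeping non-separation; the first family is
   the whole space, coded by its own bits, so that the limit singles out a
   point z, and closedness separates the families near z. *)
Section Novikov.
Variable F : nat -> (nat -> nat) -> set cantor.

(** One sequence stores the witnesses of all families; [row n] extracts that of family [n]. *)
Let row (n : nat) (a : nat -> nat) (i : nat) := a (pickle (n, i)).
Let node a t n := [set z | exists2 c, agree t a c & F n (row n c) z].
Let upd (a : nat -> nat) t m i := if i == t then m else a i.

(** Digit [t] belongs to the witness of at most one family, [n0] (0 by default). The set of that
    family is a union over the values of the digit, while the other sets do not depend on it; hence
    a union of separators at [n0] and intersections elsewhere. *)
Let separated_node a t :
  (forall m, separated (node (upd a t m) t.+1)) -> separated (node a t).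
Proof.
move=> /(_ _)/cid-/all_sig[B BP].
pose n0 := if (unpickle t : option (nat * nat)) is Some (n, i) then (n : nat) else 0%N.
have n0P (n i : nat) : n != n0 -> pickle (n, i) != t.
  by apply: contra => /eqP tE; rewrite /n0 -tE pickleK.
exists (fun n => if n == n0 then \bigcup_m B m n else [set z | forall m, B m n z]).
split=> [n|n z [c ac Fc]|z Bz].
- case: ifP => _; first by apply: borel_bigcup => m; have [] := BP m.
  by apply: borel_forall => m; have [] := BP m.
- case: ifPn => [_|nn0].
    exists (c t) => //; have [_ + _] := BP (c t); apply.
    exists c => // i; rewrite ltnS leq_eqVlt /upd; case: eqP => [->//|_ /=]; exact: ac.
  move=> m; have [_ + _] := BP m; apply; exists (upd c t m).
    move=> i; rewrite ltnS leq_eqVlt /upd; case: eqP => [//|_ /=]; exact: ac.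
  rewrite (_ : row _ _ = row n c)//; apply/funext => i.
  by rewrite /row /upd ifN// n0P.
- have := Bz n0; rewrite eqxx => -[m _ Bm].
  have [_ _ /(_ z)] := BP m; apply.
  move=> n; have [->//|nn0] := eqVneq n n0.
  by have := Bz n; rewrite (negbTE nn0).
Qed.

Lemma novikov_aux : (forall n, closed_rel (F n)) ->
  F 0 = (fun a z => forall i, z i = (a i != 0%N)) ->
  (forall z, ~ forall n, exists a, F n a z) ->
  separated (fun n => [set z | exists a, F n a z]).
Proof.
move=> Fc F0 FI.
suff : separated (node (fun=> 0%N) 0).
  case=> B [bB AB BI]; exists B; split=> // n z [a Fa]; apply: AB.
  exists (fun k => if (unpickle k : option (nat * nat)) is Some (_, i) then a i else 0%N) => //.
  by congr (F _ _ _): Fa; apply/funext => i; rewrite /row pickleK.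
apply: contrapT => nsep0.
have /(_ _)/cid-/all_sig[next nextP] : forall st : (nat -> nat) * nat, exists m,
    ~ separated (node st.1 st.2) -> ~ separated (node (upd st.1 st.2 m) st.2.+1).
  move=> [a t] /=; have [s|ns] := pselect (separated (node a t)); first by exists 0%N.
  apply: contrapT => /forallNP nm; apply: ns; apply: separated_node => m.
  by have /not_implyP[_ /contrapT] := nm m.
pose step st := (upd st.1 st.2 (next st), st.2.+1) : (nat -> nat) * nat.
pose st t := iter t step (fun=> 0%N, 0%N).
have st2 t : (st t).2 = t by elim: t => //= t ->.
have stN t : ~ separated (node (st t).1 t).
  elim: t => [//|t IH]; by move: (nextP (st t)); rewrite /= st2 => /(_ IH).
pose b i := (st i.+1).1 i.
have stb t : agree t (st t).1 b.
  elim: t => [//|t IH] i; rewrite ltnS leq_eqVlt => /predU1P[->//|it].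
  by rewrite -(IH i it) /= /upd st2 ltn_eqF.
have {}stN t : ~ separated (node b t).
  move=> bsep; apply: (stN t); rewrite (_ : node _ _ = node b t)//.
  by apply/funext => n; apply/seteqP; split => z [c bc Fcz]; exists c => // i it;
    rewrite -bc// ?stb// -stb.
(* Family 0 makes the limit of the digits single out [z]. Some row of the limit is not a witness for
   [z], since [z] is not in all the sets. *)
pose z i := row 0 b i != 0%N.
have /existsNP[n nFn] : ~ forall n, F n (row n b) z.
  by move=> Fb; apply: (FI z) => n; exists (row n b).
have [N FN] := Fc _ _ _ nFn.
have n0 : n != 0%N by apply/eqP => n0; apply: nFn; rewrite n0 F0.
have [M0 M0N] := @agree_comp nat (fun i => pickle (0%N, i)) N.
have [M MN] := @agree_comp nat (fun i => pickle (n, i)) N.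
apply: (stN (maxn M0 M)).
(* A neighbourhood of [z] contains the set of family 0, its complement that of family [n], and these
   two already have empty intersection. *)
exists (fun m => if m == 0%N then [set w | agree N w z] else
  if m == n then ~` [set w | agree N w z] else [set _ | True]); split.
- move=> m; case: ifP => _; first exact: borel_agree.
  by case: ifP => _; [apply/borelC/borel_agree|exact: borel_cst].
- move=> m w [c bc Fc']; case: ifPn => [/eqP m0 i iN|_].
    rewrite m0 F0 in Fc'; rewrite Fc' /z /row; congr (_ != _).
    by apply/esym; apply: (M0N b c) => //; apply: agree_le bc; rewrite leq_maxl.
  case: ifPn => // /eqP mn wz; move: Fc'; rewrite mn; apply: FN.
    by apply: (MN b c); apply: agree_le bc; rewrite leq_maxr.
  by move=> i iN; rewrite wz.
- by move=> w Bw; have := Bw 0%N; have := Bw n; rewrite eqxx (negbTE n0)/=.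
Qed.

End Novikov.

Theorem novikov_separation (A : nat -> set cantor) :
  (forall n, analytic (A n)) -> \bigcap_n A n = set0 -> separated A.
Proof.
move=> /(_ _)/cid2-/all_sig2[F Fc AE] A0.
pose F' n := if n is m.+1 then F m else fun a z => forall i, z i = (a i != 0%N).
have [||z Fz|B [bB AB BI]] := @novikov_aux F'.
- case=> [a z /existsNP[i zi]|n]; last exact: Fc.
  by exists i.+1 => b w ab zw /(_ i); rewrite -ab// -zw.
- by [].
- have : (\bigcap_n A n) z by move=> n _; rewrite AE; exact: (Fz n.+1).
  by rewrite A0.
- exists (B \o succn); split=> [n|n z Az|z Bz]; first exact: bB.
    by apply: (AB n.+1); rewrite /F'; move: Az; rewrite AE.
  (* Position 0 imposes nothing: the whole space lies in [B 0]. *)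
  apply: (BI z) => -[|n]; last exact: Bz.
  by apply: AB; exists (fun i => nat_of_bool (z i)) => i; case: (z i).
Qed.

Lemma lusin_separation (A A' : set cantor) : analytic A -> analytic A' ->
  A `&` A' = set0 -> exists B, [/\ borel B, A `<=` B & B `&` A' = set0].
Proof.
move=> aA aA' AA'.
pose S n := if n is 0%N then A else A'.
have aS n : analytic (S n) by case: n.
have [|B [bB AB BI]] := novikov_separation aS.
  by apply/seteqP; split=> // z Az; rewrite -AA'; split; [exact: (Az 0%N)|exact: (Az 1%N)].
exists (B 0%N); split; [exact: bB|exact: (AB 0%N)|].
apply/seteqP; split=> // z [B0z A'z]; apply: (BI z) => -[//|n].
exact: (AB n.+1).
Qed.

(* On the projection of a functional relation, the i-th bit of the value
   separates two disjoint analytic sets; Borel separators of these recover the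
   value, which makes the projection Borel. *)
Lemma borel_functional (Q : set cantor) : borel Q ->
  (forall x y y', Q (pr x y) -> Q (pr x y') -> y = y') ->
  exists (g : cantor -> cantor) (D : set cantor),
    [/\ borel D, forall i, borel [set x | g x i] &
        forall x y, Q (pr x y) <-> D x /\ y = g x].
Proof.
move=> bQ Qf.
have bbit (b : bool) i : borel [set z | prr z i = b].
  case: b; first exact: borel_bit.
  apply: (@borel_ext (~` [set z | z i.*2.+1])); last exact/borelC/borel_bit.
  by move=> z; apply/propext; rewrite /prr/=; split => [/negP/negbTE|->].
have aQ b i : analytic [set x | exists y, Q (pr x y) /\ y i = b].
  rewrite (_ : mkset _ = [set x | exists y, (Q `&` [set z | prr z i = b]) (pr x y)]).
    exact/analytic_proj/borel_analytic/borelI.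
  by apply/seteqP; split=> x [y [Qy yb]]; exists y; split=> //; move: yb; rewrite /= prrK.
have QI i : [set x | exists y, Q (pr x y) /\ y i = true] `&`
    [set x | exists y, Q (pr x y) /\ y i = false] = set0.
  apply/seteqP; split=> // x [[y [Qy yi]] [y' [/(Qf _ _ _ Qy)<-]]].
  by rewrite yi.
have /(_ _)/cid-/all_sig[B BP] i := lusin_separation (aQ true i) (aQ false i) (QI i).
pose g x i := `[< B i x >].
have bg i : borel [set x | g x i].
  rewrite (_ : mkset _ = B i); first by case: (BP i).
  by apply/seteqP; split=> x /asboolP.
have gE x y : Q (pr x y) -> y = g x.
  move=> Qxy; apply/funext => i; have [_ QB B0] := BP i; apply/esym.
  case yi : (y i); first by apply/asboolP/QB; exists y.
  apply/asboolP => Bx; suff : (set0 : set cantor) x by [].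
  by rewrite -B0; split=> //; exists y.
exists g, [set x | Q (pr x (g x))]; split=> // [|x y].
  apply: borel_preimage bQ => n; rewrite /pr.
  case: (odd n); [exact: bg|exact: borel_bit].
by split=> [Qxy|[Qx ->]//]; split; [rewrite /= -(gE x y Qxy)|exact: gE].
Qed.

Lemma finite_isolated (A : set cantor) (z : cantor) : finite_set A ->
  exists N, forall w, A w -> agree N w z -> w = z.
Proof.
move=> /finite_seqP[S ->].
(* [N] exceeds, for each member, a position where it differs from [z]; the default serves a member
   equal to [z]. *)
pose N := foldr (fun w N => maxn (xget 0%N [set i | w i != z i]).+1 N) 0%N S.
exists N => w /= wS wz; apply/funext => i; apply: contrapT => /eqP wi.
have : w (xget 0%N [set i | w i != z i]) != z (xget 0%N [set i | w i != z i]).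
  exact: (@xgetI _ 0%N [set i | w i != z i] i wi).
rewrite wz ?eqxx// /N; elim: (S) wS => //= w' S' IH; rewrite in_cons => /predU1P[->|/IH {}IH].
  by rewrite leq_max ltnS leqnn.
by rewrite leq_max IH ?orbT.
Qed.

(* Each point of a finite section is isolated in it by a basic open set; the
   pairs not isolated by the n-th basic open set form an analytic set, and
   these have empty intersection, so Novikov's theorem provides Borel pieces. *)
Theorem lusin_novikov_finite (P : set cantor) : borel P ->
  (forall x, finite_set [set y | P (pr x y)]) ->
  exists (g : nat -> cantor -> cantor) (D : nat -> set cantor),
    [/\ forall n, borel (D n), forall n i, borel [set x | g n x i] &
        forall x y, P (pr x y) <-> exists n, D n x /\ y = g n x].
Proof.
move=> bP Pfin.
pose V n := [set y : cantor | let s := odflt [::] (unpickle n : option (seq bool)) in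
  agree (size s) y (nth false s)].
have bV n : borel (V n) by exact: borel_agree.
pose R n := [set z | ~ V n (prr z)] `|`
  [set z | exists w, [/\ P (pr (prl z) w), V n w & w <> prr z]].
have aR n : analytic (P `&` R n).
  apply: analyticI; first exact: borel_analytic.
  apply: analyticU; first by apply/borel_analytic/borelC/borel_preimage => // i; exact: borel_bit.
  rewrite (_ : mkset _ = [set z | exists w, ([set u | P (pr (prl (prl u)) (prr u))] `&`
      [set u | V n (prr u)] `&` [set u | exists i, prr u i != prr (prl u) i]) (pr z w)]).
    apply/analytic_proj/borel_analytic; repeat apply: borelI.
    - apply: (@borel_preimage (fun u => pr (prl (prl u)) (prr u))) => // i.
      by rewrite /pr; case: odd; exact: borel_bit.
    - by apply: (@borel_preimage prr) => // i; exact: borel_bit.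
    - apply: borel_exists => i.
      apply: (@borel_ext (([set u | prr u i] `&` ~` [set u | prr (prl u) i]) `|`
                         (~` [set u | prr u i] `&` [set u | prr (prl u) i]))).
        move=> u; apply/propext => /=; case: (prr u i); case: (prr _ i); split=> //=;
          first [by case=> -[]|by left|by right].
      by apply: borelU; apply: borelI; rewrite ?/prr ?/prl; try apply: borelC; exact: borel_bit.
  apply/seteqP; split=> z [w]; rewrite /= ?prlK ?prrK.
    case=> Pw Vw wz; exists w; rewrite prlK prrK; split=> //; apply: contrapT => /forallNP wz'.
    by apply: wz; apply/funext => i; have /negP := wz' i; rewrite negbK => /eqP.
  by case=> -[Pw Vw] [i wz]; exists w; split=> // wE; move: wz; rewrite wE eqxx.
have [|B [bB AB BI]] := novikov_separation aR.
  apply/seteqP; split=> // z Az.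
  have Pz : P z by case: (Az 0%N).
  have [N NP] := finite_isolated (prr z) (Pfin (prl z)).
  have [_ []] := Az (pickle [seq prr z i | i <- iota 0 N]) Logic.I; rewrite /V pickleK /=.
    apply => i; rewrite size_map size_iota => iN.
    by rewrite (nth_map 0%N) ?size_iota// nth_iota.
  case=> w [Pw Vw]; apply; apply: (NP w Pw) => i iN; rewrite Vw ?size_map ?size_iota//.
  by rewrite (nth_map 0%N) ?size_iota// nth_iota.
(* A point of [P] outside [B n] is isolated in its section by [V n], so what is left of [P] there
   has at most one point in each section. *)
have /(_ _)/cid-/all_sig[g /(_ _)/cid-/all_sig[D gD]] : forall n, exists (g : cantor -> cantor) (D : set cantor),
    [/\ borel D, forall i, borel [set x | g x i] &
        forall x y, (P `\` B n) (pr x y) <-> D x /\ y = g x].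
  move=> n; apply: borel_functional.
    by apply: borelI => //; exact: borelC.
  move=> x y y' [Py nBy] [Py' nBy']; apply: contrapT => yy'.
  have Vy w : P (pr x w) -> ~ B n (pr x w) -> V n w.
    move=> Pw nBw; apply: contrapT => nVw; apply/nBw/AB; split=> //; left.
    by rewrite /= prrK.
  apply/nBy/AB; split=> //; right; exists y'; rewrite prlK prrK; split=> //.
    exact: Vy.
  exact/nesym.
exists g, D; split=> [n|n i|x y].
- by case: (gD n).
- by case: (gD n).
- split=> [Pxy|[n [Dx ->]]]; last first.
    by have [_ _ /(_ x (g n x))[_ ]] := gD n; case.
  have /existsNP[n nB] := BI (pr x y).
  by exists n; have [_ _ /(_ x y)[+ _]] := gD n; apply.
Qed.

(** * Coding a standard Borel space in Cantor space *)

Section PolishCode.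
Local Open Scope ring_scope.
Context {R : realType} {M : metricType R}.
Variable d : nat -> M.
Hypothesis dP : dense (range d).
Hypothesis Mc : complete_space M.

Let r (j : nat) : R := j.+1%:R^-1.
Let q k : nat * nat := odflt (0, 0)%N (unpickle k).
Let qK p : q (pickle p) = p. Proof. by rewrite /q pickleK. Qed.
Let r_gt0 j : 0 < r j. Proof. by rewrite invr_gt0. Qed.

Let r_small (e : R) : 0 < e -> exists j, r j < e.
Proof.
move=> e0; exists (Num.truncn e^-1); rewrite /r invf_plt ?posrE//.
have e1 : 0 < e^-1 by rewrite invr_gt0.
by have /andP[] := truncn_itv (ltW e1).
Qed.

Let dist_triangle (x y z : M) : mdist x z <= mdist x y + mdist y z.
Proof. exact: metric_triangle. Qed.

Lemma open_mdist_ball (x : M) (e : R) : open [set y | mdist x y < e].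
Proof.
rewrite openE => y /= xy; rewrite /interior -nbhs_ballE; exists (e - mdist x y) => /=.
  by rewrite subr_gt0.
by move=> z; rewrite ballEmdist /= => yz; have := dist_triangle x y z; lra.
Qed.

Let near_d x e : 0 < e -> exists i, mdist (d i) x < e.
Proof.
move=> e0; have [||y [xy [i _ iy]]] := dP (O := [set y | mdist x y < e]).
- by exists x; rewrite /= mdistxx.
- exact: open_mdist_ball.
- by exists i; rewrite metric_sym iy.
Qed.

Let limit_point (i_ : nat -> nat) :
  (forall j j', mdist (d (i_ j)) (d (i_ j')) < r j + r j') ->
  exists x, forall j, mdist (d (i_ j)) x <= r j.
Proof.
move=> iP.
have r_le j j' : (j <= j')%N -> r j' <= r j.
  by move=> jj'; rewrite /r lef_pV2 ?posrE// ler_nat.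
have [|x dx] := Mc (F := (d \o i_) @ \oo) _.
  apply/cauchy_exP => e e0; have [j jP] := r_small (divr_gt0 e0 (ltr0n R 2)).
  exists (d (i_ j)); exists j => // j' /= jj'; rewrite ballEmdist /=.
  by have := iP j j'; have := r_le _ _ jj'; lra.
exists x => j; apply/ler_addgt0Pl => e e0.
have [N _ NP] := dx _ (nbhsx_ballx x (e / 2) (divr_gt0 e0 (ltr0n R 2))).
have [j' jP] := r_small (divr_gt0 e0 (ltr0n R 2)).
have := NP (maxn N j') (leq_maxl _ _); rewrite /= ballEmdist /= metric_sym.
have := iP j (maxn N j'); have := r_le _ _ (leq_maxr N j').
by have := dist_triangle (d (i_ j)) (d (i_ (maxn N j'))) x; lra.
Qed.

Definition ball_code (x : M) : cantor := fun k => mdist (d (q k).1) x < r (q k).2.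

Let ball_codeE x i j : ball_code x (pickle (i, j)) = (mdist (d i) x < r j).
Proof. by rewrite /ball_code qK. Qed.

Lemma ball_code_inj : injective ball_code.
Proof.
move=> x y xy; apply: mdist_positivity; apply/eqP; rewrite eq_le mdist_ge0 andbT.
apply/ler_addgt0Pl => e e0; have [j jP] := r_small (divr_gt0 e0 (ltr0n R 2)).
have [i ix] := near_d x (r_gt0 j).
move: (ix); rewrite -ball_codeE xy ball_codeE => iy.
by have := dist_triangle x (d i) y; rewrite (metric_sym x (d i)); lra.
Qed.

(** Axioms for the set of basic balls around a point: some ball of each radius, any two compatible,
    each containing another with room to spare, and closure under such strict enlargement. The last
    clause fixes the digits that code no pair. *)
Let code_cond : set cantor :=
  [set z | forall j : nat, exists i : nat, z (pickle (i, j))] `&`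
  ([set z | forall p p' : nat * nat, z (pickle p) /\ z (pickle p') ->
      mdist (d p.1) (d p'.1) < r p.2 + r p'.2] `&`
  ([set z | forall p : nat * nat, z (pickle p) -> exists p' : nat * nat,
      mdist (d p.1) (d p'.1) + r p'.2 < r p.2 /\ z (pickle p')] `&`
  ([set z | forall p p' : nat * nat,
      mdist (d p.1) (d p'.1) + r p'.2 < r p.2 /\ z (pickle p') -> z (pickle p)] `&`
   [set z | forall k, z k = z (pickle (q k))]))).

(** Completeness gives the converse: the centres of members of shrinking radius converge, and the
    slack in the strict inequalities makes the limit lie in exactly the given balls. *)
Let ball_code_rangeE : range ball_code = code_cond.
Proof.
have slack i j x : mdist (d i) x < r j ->
    exists p, mdist (d p.1) x < r p.2 /\ mdist (d i) (d p.1) + r p.2 < r j.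
  move=> ix; have [|j' jP] := @r_small ((r j - mdist (d i) x) / 2).
    by rewrite divr_gt0// subr_gt0.
  have [i' i'P] := near_d x (r_gt0 j'); exists (i', j') => /=; split=> //.
  by have := dist_triangle (d i) x (d i'); rewrite (metric_sym x (d i')); lra.
apply/seteqP; split=> [_ [x _ <-]|z [z1 [z2 [z3 [z4 z5]]]]].
  split; [|split; [|split; [|split]]] => [j|[i j] [i' j']|[i j]|[i j] [i' j']|k];
    rewrite ?ball_codeE.
  - by have [i ix] := near_d x (r_gt0 j); exists i; rewrite ball_codeE.
  - case=> /= ix ix'; have := dist_triangle (d i) x (d i'); rewrite (metric_sym x (d i')); lra.
  - by move=> /slack[[i' j'] [ix ij]]; exists (i', j'); rewrite ball_codeE.
  - by case=> ij ix; have := dist_triangle (d i) (d i') x; move: ij ix => /=; lra.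
  - by rewrite ?qK.
have /(_ _)/cid-/all_sig[i_ iP] := z1.
have [|x xP] := @limit_point i_; first by move=> j j'; exact: (z2 (_, _) (_, _)).
have zx i j : z (pickle (i, j)) -> mdist (d i) x <= r j.
  move=> zij; apply/ler_addgt0Pl => e e0.
  have [j' jP] := r_small (divr_gt0 e0 (ltr0n R 2)).
  have /= := z2 (i, j) (i_ j', j') (conj zij (iP j')).
  by have := xP j'; have := dist_triangle (d i) (d (i_ j')) x; lra.
exists x => //; apply/funext => k; apply/idP/idP; rewrite z5 /ball_code; last first.
  move=> /z3[[i j] [/= ij /zx ix]].
  by have := dist_triangle (d (q k).1) (d i) x; move: ix ij; lra.
move=> kx; have [|j' jP] := @r_small ((r (q k).2 - mdist (d (q k).1) x) / 2).
  by rewrite divr_gt0// subr_gt0.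
apply: z4 (i_ j', j') _; split=> //=; have := xP j'.
by have := dist_triangle (d (q k).1) x (d (i_ j')); rewrite (metric_sym x (d (i_ j'))); lra.
Qed.

Lemma borel_ball_code_range : borel (range ball_code).
Proof.
have bit p : borel [set z : cantor | z (pickle p)] by exact: borel_bit.
rewrite ball_code_rangeE; apply: borelI.
  by apply: borel_forall => j; apply: borel_exists => i; exact: bit.
apply: borelI.
  apply: borel_forall => p; apply: borel_forall => p'; apply: borel_imply.
    by apply: borelI; exact: bit.
  exact: borel_cst.
apply: borelI.
  apply: borel_forall => p; apply: borel_imply; first exact: bit.
  apply: borel_exists => p'; apply: borelI; [exact: borel_cst|exact: bit].
apply: borelI.
  apply: borel_forall => p; apply: borel_forall => p'; apply: borel_imply; last exact: bit.
  by apply: borelI; [exact: borel_cst|exact: bit].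
apply: borel_forall => k; apply: (@borel_ext (
    [set z | z k -> z (pickle (q k))] `&` [set z | z (pickle (q k)) -> z k])).
  move=> z; apply/propext => /=; split=> [[zk kz]|->//].
  by apply/esym; move: zk kz; case: (z k) => [/(_ isT)|_ ] ; case: (z _) => // /(_ isT).
by apply: borelI; apply: borel_imply; exact: borel_bit.
Qed.

(** An open set is the union of the basic balls that it contains, and lying in a basic ball is one
    bit of the code. *)
Lemma ball_code_measurable (A : set M) : <<s @open M >> A ->
  exists2 B, borel B & A = ball_code @^-1` B.
Proof.
move: A; apply: smallest_sub.
  split.
  - by exists set0; [exact: (borel_cst False)|rewrite preimage_set0].
  - by move=> A [B bB ->]; exists (~` B); [exact: borelC|rewrite setTD].
  - move=> A /(_ _)/cid2-/all_sig2[B bB AE]; exists (\bigcup_n B n).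
      exact: borel_bigcup.
    by rewrite preimage_bigcup; apply: eq_bigcupr.
move=> U oU.
exists [set z | exists p : nat * nat, [set y | mdist (d p.1) y < r p.2] `<=` U /\ z (pickle p)].
  by apply: borel_exists => p; apply: borelI; [exact: borel_cst|exact: borel_bit].
apply/seteqP; split=> [x Ux|x [[i j] [/= + ]]]; last by rewrite ball_codeE; exact.
move: (oU); rewrite openE => /(_ x Ux); rewrite /interior -nbhs_ballE => -[e /= e0 eU].
have [j jP] := r_small (divr_gt0 e0 (ltr0n R 2)).
have [i ix] := near_d x (r_gt0 j).
exists (i, j) => /=; rewrite ball_codeE; split=> // y /= iy; apply: eU.
by rewrite ballEmdist /=; have := dist_triangle x (d i) y; rewrite (metric_sym x (d i)); lra.
Qed.

End PolishCode.

Lemma standard_borel_code (R : realType) (d : measure_display) (X : measurableType d) (x0 : X) :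
  standard_borel R X -> exists iota : X -> cantor,
    [/\ injective iota, forall i, measurable [set x | iota x i], borel (range iota) &
        forall A, measurable A -> exists2 B, borel B & A = iota @^-1` B].
Proof.
move=> [M [f [[g fK gK] [D /countable_injP[c cI] dD] Mc XE]]].
(* A sequence running through [D], which may be finite: the inverse of the injection [c], with a
   default value. *)
pose e i := xget (f x0) [set m | D m /\ c m = i].
have De : D `<=` range e.
  move=> m Dm; exists (c m) => //; have [De ce] := @xgetI _ (f x0) [set m' | D m' /\ c m' = c m] m (conj Dm erefl).
  by apply: cI => //; rewrite inE.
have de : dense (range e).
  by move=> O O0 oO; have [y [Oy Dy]] := dD O O0 oO; exists y; split=> //; exact: De.
exists (ball_code e \o f); split.
- by apply: inj_comp; [exact: ball_code_inj|exact: can_inj fK].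
- move=> i; rewrite XE; exists [set m | ball_code e m i] => //.
  by apply: sub_sigma_algebra; exact: open_mdist_ball.
- rewrite (_ : range _ = range (ball_code e)); first exact: borel_ball_code_range.
  apply/seteqP; split=> [_ [x _ <-]|_ [m _ <-]]; first by exists (f x).
  by exists (g m) => //=; rewrite gK.
- move=> A; rewrite XE => -[B /(ball_code_measurable de)[B' bB' ->] <-].
  by exists B'.
Qed.

(** * Borel enumeration of the connectedness relation *)

Section Enumeration.
Context {d : measure_display} {X : measurableType d}.
Variable iota : X -> cantor.
Hypothesis iota_inj : injective iota.
Hypothesis iota_bit : forall i, measurable [set x | iota x i].
Hypothesis iota_range : borel (range iota).
Hypothesis iota_pre : forall A, measurable A -> exists2 B, borel B & A = iota @^-1` B.

Lemma measurable_code B : borel B -> measurable (iota @^-1` B).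
Proof.
elim=> [i|A _ mA|A _ mA]; first exact: iota_bit.
- by rewrite preimage_setC; exact: measurableC.
- by rewrite preimage_bigcup; exact: bigcupT_measurable.
Qed.

Lemma product_code (P : set (X * X)) : measurable P ->
  exists2 B, borel B & P = [set p | B (pr (iota p.1) (iota p.2))].
Proof.
move: P; apply: smallest_sub.
  split.
  - by exists set0; [exact: (borel_cst False)|].
  - by move=> A [B bB ->]; exists (~` B); [exact: borelC|rewrite setTD].
  - move=> A /(_ _)/cid2-/all_sig2[B bB AE]; exists (\bigcup_n B n).
      exact: borel_bigcup.
    by apply/seteqP; split=> p [n _]; [rewrite AE|]; exists n => //; rewrite AE.
move=> A [[A' /iota_pre[B bB ->] <-]|[A' /iota_pre[B bB ->] <-]].
  exists (prl @^-1` B); first by apply: borel_preimage bB => i; exact: borel_bit.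
  by apply/seteqP; split=> p; rewrite /= ?setTI prlK //=; move=> [].
exists (prr @^-1` B); first by apply: borel_preimage bB => i; exact: borel_bit.
by apply/seteqP; split=> p; rewrite /= ?setTI prrK //=; move=> [].
Qed.

Lemma measurable_uniformization (P : set (X * X)) : measurable P ->
  (forall x, finite_set (xsection P x)) ->
  exists h : nat -> X -> X, exists D : nat -> set X,
  [/\ forall n, measurable_fun setT (h n), forall n, measurable (D n) &
      forall x y, P (x, y) <-> exists n, D n x /\ y = h n x].
Proof.
move=> mP Pfin; have [B bB PE] := product_code mP.
have PB x y : P (x, y) <-> B (pr (iota x) (iota y)) by rewrite PE.
have bR f : (f = prl \/ f = prr) -> borel (f @^-1` range iota).
  by case=> ->; apply: borel_preimage iota_range => i; exact: borel_bit.
(* Restricting both coordinates to the range of [iota] makes every section empty or the image of a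
   section of [P]. *)
have bP : borel (B `&` (prl @^-1` range iota) `&` (prr @^-1` range iota)).
  by apply: borelI; [apply: borelI|] => //; apply: bR; [left|right].
have [x|g [D [bD bg gD]]] := lusin_novikov_finite bP.
  have [[x' _ <-]|xN] := pselect (range iota x); last first.
    rewrite (_ : mkset _ = set0)//; apply/seteqP; split=> // y [[_ /=]].
    by rewrite prlK.
  apply: (sub_finite_set _ (finite_image iota (Pfin x'))) => w [[+ _] [y _ yE]].
  rewrite prrK in yE; rewrite -yE => By; exists y => //.
  by apply/xsectionP/PB.
have gDE n x : D n (iota x) -> range iota (g n (iota x)).
  move=> Dx; have /gD : exists n', D n' (iota x) /\ g n (iota x) = g n' (iota x) by exists n.
  by case=> _ /=; rewrite prrK.
pose h n x := if `[< D n (iota x) >] then xget x [set y | iota y = g n (iota x)] else x.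
have hE n x : D n (iota x) -> iota (h n x) = g n (iota x).
  move=> Dx; rewrite /h asboolT//; have [y _ yE] := gDE _ _ Dx.
  exact: (@xgetI _ x [set y | iota y = g n (iota x)] y).
exists h, (fun n => iota @^-1` D n); split=> [n|n|x y].
- move=> _ A mA; have [A' bA' AE] := iota_pre mA; rewrite setTI.
  rewrite (_ : _ @^-1` _ = (iota @^-1` D n `&` iota @^-1` (g n @^-1` A')) `|`
                           (~` (iota @^-1` D n) `&` A)).
    apply: measurableU; apply: measurableI => //.
    + exact: measurable_code.
    + by apply/measurable_code/borel_preimage.
    + exact/measurableC/measurable_code.
  apply/seteqP; split=> x /=; have [Dx|nDx] := pselect (D n (iota x)).
  + by rewrite AE /= hE//; left.
  + by rewrite /h asboolF//; right.
  + by case=> -[//= _]; rewrite AE /= hE.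
  + by case=> -[//= _]; rewrite /h asboolF.
- exact: measurable_code.
- split=> [/PB Bxy|[n [/= Dx ->]]].
    have /gD[n [Dn yE]] : (B `&` prl @^-1` range iota `&` prr @^-1` range iota) (pr (iota x) (iota y)).
      by split; [split=> //|]; rewrite /= ?prlK ?prrK; [exists x|exists y].
    by exists n; split=> //; apply: iota_inj; rewrite hE.
  apply/PB; rewrite hE//.
  have /gD : exists n', D n' (iota x) /\ g n (iota x) = g n' (iota x) by exists n.
  by case=> -[].
Qed.

(** Uniformizing [G] gives countably many partial neighbour functions. Made total by standing still,
    their finite compositions reach exactly the component. *)
Lemma connectedness_enumeration (G : set (X * X)) : measurable G -> locally_finite G ->
  exists e : nat -> X -> X, (forall n, measurable_fun setT (e n)) /\
    forall x y, connectedness G (x, y) <-> exists n, y = e n x.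
Proof.
move=> mG Gfin.
have [h [D [mh mD GE]]] := measurable_uniformization mG Gfin.
pose k n x := if `[< D n x >] then h n x else x.
have mk n : measurable_fun setT (k n).
  move=> _ A mA; rewrite setTI.
  rewrite (_ : _ @^-1` _ = (D n `&` h n @^-1` A) `|` (~` D n `&` A)).
    apply: measurableU; apply: measurableI => //; last exact: measurableC.
    by rewrite -[_ @^-1` _]setTI; exact: mh.
  apply/seteqP; rewrite /k; split=> x /=; have [Dx|nDx] := pselect (D n x);
    rewrite ?(asboolT Dx) ?(asboolF nDx).
  - by left.
  - by right.
  - by case=> -[].
  - by case=> -[].
pose kk (s : seq nat) x := foldl (fun y n => k n y) x s.
pose dec n : seq nat := odflt [::] (unpickle n).
exists (fun n => kk (dec n)); split=> [n|x y].
  rewrite /dec; case: unpickle => [s|] /=; last exact: measurable_id.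
  elim/last_ind: s => [|s m IH]; first exact: measurable_id.
  rewrite (_ : kk _ = k m \o kk s); first exact: measurableT_comp.
  by apply/funext => x; rewrite /kk foldl_rcons.
split.
  case=> s; rewrite /= => + <-; suff : path (adj G) x s -> exists t, last x s = kk t x.
    by move=> /[apply] -[t tE]; exists (pickle t); rewrite /dec pickleK.
  elim: s x => [|z s IH] x /=; first by exists [::].
  case/andP => /asboolP/GE[n [Dn ->]] /IH[t ->]; exists (n :: t).
  by rewrite /kk /= /k asboolT.
case=> n ->; elim: (dec n) x => {n y} [|m s IH] x; first by exists [::].
have [t tp tl] := IH (k m x); rewrite /kk /= in tp tl *.
rewrite /k; case: asboolP => Dm; last first.
  by exists t => //; rewrite /= /k asboolF // in tp tl *.
rewrite /k asboolT// in tp tl; exists (h m x :: t) => //=.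
by rewrite tp andbT; apply/asboolP/GE; exists m.
Qed.

End Enumeration.

(** * Cuts of a connected locally finite graph *)

Definition crossing (T : Type) (C H K : set T) :=
  [/\ exists x, H x /\ K x, exists x, H x /\ ~ K x,
      exists x, ~ H x /\ K x & exists x, [/\ C x, ~ H x & ~ K x]].

Lemma path_exit (T : choiceType) (g : set (T * T)) (H : set T) x s :
  path (adj g) x s -> H x -> ~ H (last x s) -> exists a b, [/\ g (a, b), H a & ~ H b].
Proof.
elim: s x => [//|y s IH] x /= /andP[/asboolP xy ys] Hx nHl.
by have [Hy|nHy] := pselect (H y); [exact: IH ys Hy nHl|exists x, y].
Qed.

Section Cuts.
Variables (T : choiceType) (C : set T) (g : set (T * T)).
Hypothesis gC : g `<=` C `*` C.
Hypothesis gsym : forall x y, g (x, y) -> g (y, x).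
Hypothesis gconn : connected_on g C.
Hypothesis glf : locally_finite g.

Lemma cplK A : A `<=` C -> C `\` (C `\` A) = A.
Proof. move=> sAC; apply/seteqP; split=> [x [Cx nCAx]|x Ax]; last by split; [exact: sAC|case].
by apply: contrapT => nAx; apply: nCAx. Qed.

Lemma vbd_cpl A : A `<=` C -> vbd C g (C `\` A) = vbd C g A.
Proof. by move=> sAC; rewrite /vbd /outer_vbd (cplK sAC) setUC. Qed.

Lemma vbdP H a b : H `<=` C -> g (a, b) -> H a -> ~ H b -> vbd C g H a /\ vbd C g H b.
Proof.
move=> sHC gab Ha nHb; have [/= Ca Cb] := gC gab; split.
  by left; split => //; exists b.
by right; split; [split|exists a => //; rewrite ?cplK//; exact: gsym].
Qed.

Lemma vbd_sub H : H `<=` C -> vbd C g H `<=` C.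
Proof. by move=> sHC x [[/sHC]//|[[]]]. Qed.

Lemma connected_exit A H x y : connected_on g A -> A x -> A y -> H x -> ~ H y ->
  exists a b, [/\ g (a, b), A a, A b, H a & ~ H b].
Proof.
move=> cA Ax Ay Hx nHy; have [s] := cA (x, y) (conj Ax Ay).
move=> /= xs sy; rewrite -sy in nHy; have [a [b [[gab [/= Aa Ab]] Ha nHb]]] := path_exit xs Hx nHy.
by exists a, b.
Qed.

Lemma cut_exit H : H `<=` C -> H <> set0 -> H <> C ->
  exists a b, [/\ g (a, b), H a & ~ H b].
Proof.
move=> sHC H0 H1; have /set0P[x Hx] : H != set0 by exact/eqP.
have [y [Cy nHy]] : exists y, C y /\ ~ H y.
  apply: contrapT => /forallNP nC; apply: H1; apply/seteqP; split=> // y Cy.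
  by apply: contrapT => nHy; apply: (nC y).
have [a [b [gab _ _ Ha nHb]]] := connected_exit gconn (sHC _ Hx) Cy Hx nHy.
by exists a, b.
Qed.

Lemma vbd_neq0 H : H `<=` C -> H <> set0 -> H <> C -> vbd C g H !=set0.
Proof.
move=> sHC H0 H1; have [a [b [gab Ha nHb]]] := cut_exit sHC H0 H1.
by exists a; have [] := vbdP sHC gab Ha nHb.
Qed.

Lemma inward_ebdI H a b : H `<=` C -> g (a, b) -> H a -> ~ H b -> inward_ebd C g H (b, a).
Proof.
move=> sHC gab Ha nHb; split; first exact: gsym.
have [/= Ca Cb] := gC gab; split=> /=; last by split=> //; exists b.
by split; [split|exists a; [rewrite cplK|exact: gsym]].
Qed.

(* If one side of K missed the boundary of H, that side, being connected, would
   lie within one side of H. *)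
Lemma crossing_separates H K : is_cut C g H -> is_cut C g K -> crossing C H K ->
  exists a b, [/\ vbd C g H a, vbd C g H b, K a & ~ K b].
Proof.
move=> [[sHC _] _ _] [[sKC _] cK cK'] [[x [Hx Kx]] [y [Hy nKy]] [z [nHz Kz]] [w [Cw nHw nKw]]].
have [a [b [gab Ka _ Ha nHb]]] := connected_exit cK Kx Kz Hx nHz.
have [||a' [b' [gab' [_ nKa'] _ Ha' nHb']]] := connected_exit cK' _ _ Hy nHw.
- by split => //; exact: sHC.
- by split.
exists a, a'; split=> //; first by have [] := vbdP sHC gab Ha nHb.
by have [] := vbdP sHC gab' Ha' nHb'.
Qed.

(** * Crossings, ends and properness of the walls *)

Section Pocset.
Variable S : set (set T).
Hypothesis Spoc : cut_pocset C g S.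
Hypothesis Ssep : finitely_separating C S.
Hypothesis Sdense : dense_towards_ends C g S.

(** By [crossing_separates] such a [K] splits a pair from the finite boundary of [H], and each pair
    is split by finitely many members. *)
Lemma finite_crossing H : S H -> finite_set [set K | S K /\ crossing C H K].
Proof.
have [Scut _ _] := Spoc; move=> SH; have [[sHC Hfin] _ _] := Scut _ SH.
apply: (@sub_finite_set _ _ (\bigcup_(a in vbd C g H) \bigcup_(b in vbd C g H)
    [set K | [/\ S K, K a & ~ K b]])); last first.
  do 2 (apply: bigcup_finite => // ? ?); apply: Ssep; exact: (vbd_sub sHC).
move=> K [SK HK].
have [a [b [Ha Hb Ka nKb]]] := crossing_separates (Scut _ SH) (Scut _ SK) HK.
by exists a => //; exists b.
Qed.

(** Deleting a vertex alters the boundary only at that vertex and its finitely many neighbours. *)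
Lemma finite_vbd_algebraD1 A x : finite_vbd_algebra C g A -> finite_vbd_algebra C g (A `\ x).
Proof.
move=> [sAC Afin]; split; first by move=> y [/sAC].
apply: (@sub_finite_set _ _ (vbd C g A `|` ([set x] `|` xsection g x))).
  move=> y [[[Ay yx] [z [Cz nAz] gyz]]|[[Cy nAy] [z [Cz /= nAz] gyz]]].
    case: (eqVneq z x) gyz => [->|zx] gyz; first by right; right; apply/xsectionP/gsym.
    left; have nAz' : ~ A z by move=> Az; apply: nAz; split => //; apply/eqP.
    by have [] := vbdP sAC gyz Ay nAz'.
  have [->|yx] := eqVneq y x; first by right; left.
  have nAy' : ~ A y by move=> Ay; apply: nAy; split => //; apply/eqP.
  have [Az _] : (A `\ x) z by apply: contrapT => nAz'; apply: nAz.
  by left; have [] := vbdP sAC (gsym gyz) Az nAy'.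
rewrite finite_setU; split=> //; rewrite finite_setU; split; [exact: finite_set1|exact: glf].
Qed.

(* A free ultrafilter on an infinite set of vertices traces an end on the
   finite-boundary algebra; density then yields arbitrarily long descending
   chains of cuts in that end. *)
Lemma proper_walling (Y : set T) x m : Y `<=` C -> infinite_set Y -> C x ->
  exists2 y, Y y & exists s : seq (set T),
    [/\ uniq s, size s = m & forall H, H \in s -> [/\ S H, H y & ~ H x]].
Proof.
move=> YC Yinf Cx.
(* Sets containing almost all of [Y]; an ultrafilter extending this filter has no finite member. *)
pose F : set_system T := [set A | finite_set (Y `\` A)].
have FF : ProperFilter F.
  split; first by rewrite /F /= setD0.
  split.
  - by rewrite /F /= setDT; exact: finite_set0.
  - by move=> A B; rewrite /F /= setDIr finite_setU.
  - by move=> A B AB; apply: sub_finite_set; exact: setDS.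
have [U [UU FU]] := ultraFilterLemma FF.
have PU : ProperFilter U by exact: ultra_proper.
have UI A B : U A -> U B -> U (A `&` B) by exact: filterI.
have Uex A : U A -> exists z, A z by exact: filter_ex.
have U_inf A : U A -> infinite_set A.
  move=> UA fA; have UcA : U (~` A).
    apply: FU; rewrite /F /= setDE setCK; exact: finite_setIr.
  by have /Uex[z []] := UI _ _ UA UcA.
have UY : U Y by apply: FU; rewrite /F /= setDv; exact: finite_set0.
have U_D1 A a : U A -> U (A `\ a).
  move=> UA; apply: UI => //; apply: FU; rewrite /F /= setDE setCK.
  by apply: finite_setIr; exact: finite_set1.
pose p := finite_vbd_algebra C g `&` U.
have pC : finite_vbd_algebra C g C.
  split=> //; rewrite (_ : vbd C g C = set0); first exact: finite_set0.
  by apply/seteqP; split=> // y [[_ [z []]]|[[]]].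
have pend : is_end C g p.
  split.
    split.
    - by move=> A [].
    - by split=> //; apply: filterS UY.
    - by case=> _ /U_inf; apply; exact: finite_set0.
    - move=> A B [[sAC Afin] UA] [[sBC Bfin] UB]; split; last exact: UI.
      split; first by move=> y [/sAC].
      apply: (@sub_finite_set _ _ (vbd C g A `|` vbd C g B)); last by rewrite finite_setU.
      move=> y [[[Ay By] [z [Cz nABz] gyz]]|[[Cy nABy] [z [Cz nABz] gyz]]].
        have [Az|nAz] := pselect (A z).
          have nBz : ~ B z by move=> Bz; apply: nABz.
          by right; have [] := vbdP sBC gyz By nBz.
        by left; have [] := vbdP sAC gyz Ay nAz.
      have [Az Bz] : (A `&` B) z by apply: contrapT => h; apply: nABz.
      have [Ay|nAy] := pselect (A y).
        have nBy : ~ B y by move=> By; apply: nABy.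
        by right; have [] := vbdP sBC (gsym gyz) Bz nBy.
      by left; have [] := vbdP sAC (gsym gyz) Az nAy.
    - by move=> A A' [_ UA] BA' AA'; split => //; exact: filterS AA' UA.
    - move=> A [sAC Afin]; have [UA|UcA] := in_ultra_setVsetC A UU; first by left; split.
      right; split; first by split; [exact: subDsetl|rewrite vbd_cpl].
      by apply: filterS (UI _ _ UY UcA) => y [/YC].
  (* A generator would be a least member of [p], yet removing a point from it leaves a member. *)
  case=> A0 BA0 pE; have [_ UA0] : p A0 by rewrite pE; split.
  have [a A0a] := Uex _ UA0.
  have : p (A0 `\ a) by split; [exact: finite_vbd_algebraD1|exact: U_D1].
  by rewrite pE => -[_ /(_ a A0a)][_]; apply.
(* The invariant keeps a member [A] of the end strictly inside every cut chosen so far; the next cut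
   lies inside [A], hence is new. *)
have chain : exists s : seq (set T), [/\ uniq s, size s = m,
    forall H, H \in s -> S H /\ ~ H x &
    exists2 A, p A & A `<=` ~` [set x] /\ forall H, H \in s -> A `<=` H /\ A <> H].
  elim: m => [|m [s [us sm sP [A pA [Ax As]]]]].
    exists [::]; split=> //; exists (C `\ x); last by split=> // y [].
    split; first exact: finite_vbd_algebraD1.
    by apply: U_D1; apply: filterS UY.
  have [H [SH pH HA]] := Sdense pend pA.
  exists (H :: s); split.
  - rewrite /= us andbT; apply/negP => /As[AH]; apply.
    by apply/seteqP.
  - by rewrite /= sm.
  - move=> K; rewrite inE => /predU1P[->|/sP//]; split=> // /HA/Ax.
    by apply.
  - have [a Ha] := Uex _ pH.2.
    (* Dropping [a] makes the inclusion in [H] strict. *)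
    exists (H `\ a); first by split; [apply/finite_vbd_algebraD1; case: pH|apply: U_D1; case: pH].
    split; first by move=> y [/HA/Ax].
    move=> K; rewrite inE => /predU1P[->|Ks].
      by split; [exact: subDsetl|move=> HE; move: Ha; rewrite -HE => -[_]; apply].
    have [AK _] := As _ Ks; split; first by move=> y [/HA/AK].
    by move=> HK; move: (AK _ (HA _ Ha)); rewrite -HK => -[_]; apply.
have [s [us sm sP [A [_ UA] [_ As]]]] := chain.
have /Uex[y [Yy Ay]] := UI _ _ UY UA.
exists y => //; exists s; split=> // H Hs; have [SH nHx] := sP _ Hs.
by split=> //; have [/(_ y Ay)] := As _ Hs.
Qed.

End Pocset.

(** A path from the head of a boundary edge that never crosses a boundary edge outwards stays in
    [H], and connectedness of [H] makes such paths reach all of it. So the code determines [H] by a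
    quantifier over finite paths. *)
Lemma cut_from_inward_ebd H y : is_cut C g H -> H <> set0 -> H <> C ->
  H y <-> exists p s, [/\ inward_ebd C g H p,
    path (fun u v => `[< g (u, v) /\ ~ inward_ebd C g H (v, u) >]) p.2 s &
    last p.2 s = y].
Proof.
move=> [[sHC _] cH _] H0 H1; split.
  move=> Hy; have [a [b [gab Ha nHb]]] := cut_exit sHC H0 H1.
  have [s /= aS sy] := cH (a, y) (conj Ha Hy).
  exists (b, a), s; split=> //=; first exact: inward_ebdI.
  elim: s a aS {Ha nHb gab sy} => //= z s IH a /andP[/asboolP[gaz [/= Ha Hz]] zs].
  rewrite IH// andbT; apply/asboolP; split=> //.
  by case=> _ [/= [[_ nHz] _] _].
case=> -[a b] [s [[gab [_ [/= Hb _]]] bs <-]].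
elim: s b Hb bs {gab} => //= z s IH b Hb /andP[/asboolP[gbz nbd] zs].
apply: IH zs; apply: contrapT => nHz; apply: nbd; exact: inward_ebdI.
Qed.

End Cuts.

(** * The median graph of orientations and its canonical tree *)

Section Definitions.
Variables (T : choiceType) (C : set T) (HS : set (set T)).
Variables (col : set T -> nat) (b : set T -> T) (dec : nat -> T -> set (set T)).
Variable le : T -> T -> Prop.
Implicit Types (v w u : set (set T)) (H K L : set T).

(* Vertices of the median graph: orientations of all walls that are at finite
   distance from the principal ones. *)
Definition orientation v :=
  [/\ v `<=` HS, forall H, HS H -> (v (C `\` H) <-> ~ v H),
      forall H K, v H -> HS K -> H `<=` K -> v K &
      forall x, C x -> finite_set [set H | v H /\ ~ H x]].

Definition principal (x : T) : set (set T) := [set H | HS H /\ H x].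

Definition flip_edge v w H := [/\ orientation v, orientation w & v `\` w = [set H]].

(** This expresses that [v] and [w] stay in one component when the hyperplanes of colour at least
    [n] are deleted. *)
Definition col_below n v w := forall H, v H -> ~ w H -> (col H < n)%N.

(* Deleting the hyperplanes of colour larger than [col H] splits the median
   graph into components; [hyperplane_end H v u] says that [u] is an end of an
   edge of the hyperplane of [H] in the component of [v].  The tree keeps one
   edge of the hyperplane in each component. *)
Definition hyperplane_end H v u := (exists u', flip_edge u u' H \/ flip_edge u u' (C `\` H)) /\
  col_below (col H).+1 u v.

(** [dec] enumerates orientations from a point; starting at [b H] makes the choice depend only on
    the wall and the component. *)
Definition selected H v u := hyperplane_end H v u /\
  exists i, dec i (b H) = u /\ forall j, (j < i)%N -> ~ hyperplane_end H v (dec j (b H)).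

Definition median_tree v w := exists H, flip_edge v w H /\ (selected H v v \/ selected H v w).

Fixpoint walk k v w := if k is k'.+1 then exists u, median_tree v u /\ walk k' u w else v = w.

Definition walk_to_point k v x := C x /\ walk k v (principal x).

(* Ties in the tree distance are broken by [le]; this makes the Voronoi cells of
   the points connected in the tree. *)
Definition nearest_at k v x := [/\ walk_to_point k v x,
  forall j y, (j < k)%N -> ~ walk_to_point j v y & forall y, walk_to_point k v y -> le x y].

Definition nearest v x := exists k, nearest_at k v x.

(** The first two cases concern points with equal principal orientations: all but the least become
    leaves attached to the least. The third contracts the tree along the cells. *)
Definition point_tree x y := [/\ C x, C y, x <> y & [\/ nearest (principal x) y,
  nearest (principal y) x | exists v w, [/\ median_tree v w, nearest v x & nearest w y]]].

End Definitions.

Lemma path_max (A : eqType) (f : A -> A -> nat) (a : A) (s : seq A) : s != [::] ->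
  exists s1 c s2, s = s1 ++ c :: s2 /\
    path (fun p q => f p q <= f (last a s1) c)%N a s.
Proof.
elim: s a => //= c [|d s] IH a _; first by exists [::], c, [::]; rewrite /= leqnn.
have [s1 [e [s2 [sE fs]]]] := IH c isT.
have [fac|fac] := leqP (f a c) (f (last c s1) e).
  by exists (c :: s1), e, s2; rewrite sE /= fac -sE.
exists [::], c, (d :: s); split=> //; rewrite /= leqnn /=.
apply: sub_path fs => p q fpq; exact: leq_trans (ltnW fac).
Qed.

Lemma path_enter (A : eqType) (R : rel A) (P : A -> Prop) x (s : seq A) :
  path R x s -> P x -> ~ P (last x s) ->
  exists c d, [/\ c \in x :: s, d \in s, R c d, P c & ~ P d].
Proof.
elim: s x => //= y s IH x /andP[xy ys] Px nPl.
have [Py|nPy] := pselect (P y).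
  have [c [d [cs ds cd Pc nPd]]] := IH y ys Py nPl.
  by exists c, d; split=> //; rewrite inE ?cs ?ds orbT.
by exists x, y; split=> //; rewrite mem_head.
Qed.

(** * Orientations, flips and hyperplane ends *)

Section Orientations.
Variables (T : choiceType) (C : set T) (HS : set (set T)).
Variables (col : set T -> nat) (b : set T -> T) (dec : nat -> T -> set (set T)).
Variable le : T -> T -> Prop.
Implicit Types (v w u : set (set T)) (H K L : set T).

Hypothesis HS_sub : forall H, HS H -> H `<=` C.
Hypothesis HS_neq0 : forall H, HS H -> H !=set0.
Hypothesis HS_cpl : forall H, HS H -> HS (C `\` H).
Hypothesis HS_sep : finitely_separating C HS.
Hypothesis HS_proper : forall (Y : set T) x m, Y `<=` C -> infinite_set Y -> C x ->
  exists2 y, Y y & exists s : seq (set T),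
    [/\ uniq s, size s = m & forall H, H \in s -> [/\ HS H, H y & ~ H x]].
Hypothesis col_cpl : forall H, HS H -> col (C `\` H) = col H.
Hypothesis col_nested : forall H K, HS H -> HS K -> col H = col K -> ~ crossing C H K.
Hypothesis b_in : forall H, HS H -> C (b H).
Hypothesis b_cpl : forall H, HS H -> b (C `\` H) = b H.
Hypothesis dec_surj : forall x u, C x -> orientation C HS u -> exists i, dec i x = u.
Hypothesis le_min : forall A : set T, finite_set A -> A !=set0 ->
  exists2 x, A x & forall y, A y -> le x y.
Hypothesis le_anti : forall x y, le x y -> le y x -> x = y.

Local Notation orient := (orientation C HS).
Local Notation pr := (principal HS).
Local Notation edge := (flip_edge C HS).
Local Notation below := (col_below col).
Local Notation hend := (hyperplane_end C HS col).
Local Notation sel := (selected C HS col b dec).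
Local Notation tree := (median_tree C HS col b dec).
Local Notation wlk := (walk C HS col b dec).
Local Notation near := (nearest C HS col b dec le).

Let cpl2 H : HS H -> C `\` (C `\` H) = H.
Proof. by move=> /HS_sub; exact: cplK. Qed.

Lemma orient_cpl v H : orient v -> v H -> ~ v (C `\` H).
Proof. by move=> [vHS vc _ _] vH; rewrite vc; [|exact: vHS]; apply. Qed.

Lemma orient_meet v H K : orient v -> v H -> v K -> exists x, H x /\ K x.
Proof.
move=> ov vH vK; have [vHS vc vup _] := ov; apply: contrapT => /forallNP HK.
apply: (orient_cpl ov vH); apply: (vup K) => //; first exact/HS_cpl/vHS.
move=> x Kx; split; first by apply: HS_sub Kx; exact: vHS.
by move=> Hx; apply: (HK x).
Qed.

Lemma orient_principal x : C x -> orient (pr x).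
Proof.
move=> Cx; split.
- by move=> H [].
- move=> H HH; split=> [[_ [_ nHx]] []//|nH]; split; first exact: HS_cpl.
  by split=> // Hx; apply: nH.
- by move=> H K [HH Hx] HK sHK; split=> //; exact: sHK.
- move=> y Cy; apply: sub_finite_set (HS_sep Cx Cy) => H [[HH Hx] nHy].
  by split.
Qed.

(** Both orientations are compared with the principal one at [x0]. *)
Lemma orient_diff_finite x0 v w : C x0 -> orient v -> orient w -> finite_set (v `\` w).
Proof.
move=> Cx [vHS vc vup vf] [wHS wc wup wf].
apply: (@sub_finite_set _ _ ([set H | v H /\ ~ H x0] `|`
    [set C `\` H | H in [set H | w H /\ ~ H x0]])).
  move=> H [vH nwH]; have HH := vHS _ vH.
  have [Hx|nHx] := pselect (H x0); last by left.
  by right; exists (C `\` H); [split; [exact/wc|case]|exact: cpl2].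
by rewrite finite_setU; split; [exact: vf|exact/finite_image/wf].
Qed.

Lemma seq_min (s : seq (set T)) H : H \in s ->
  exists2 K, K \in s & forall L, L \in s -> L `<=` K -> L = K.
Proof.
elim: s H => //= K0 [|K1 s] IH H _.
  by exists K0; rewrite ?mem_head// => L; rewrite inE => /eqP.
have [K Ks Kmin] := IH K1 (mem_head _ _).
have [K0K|nK0K] := pselect (K0 `<=` K); last first.
  exists K; first by rewrite inE Ks orbT.
  by move=> L; rewrite inE => /predU1P[->/nK0K|/Kmin].
exists K0; first exact: mem_head.
move=> L; rewrite inE => /predU1P[//|Ls] LK0; apply/seteqP; split=> //.
have -> // : L = K by apply: Kmin => //; exact: subset_trans K0K.
Qed.

(** A wall minimal among the members of [v] outside [w] is minimal in [v]: a smaller member of [v]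
    lying in [w] would force it into [w]. Reversing a minimal member preserves upward closure. *)
Lemma flip_step x0 v w H : C x0 -> orient v -> orient w -> v H -> ~ w H ->
  exists v' K, [/\ edge v v' K, v K, ~ w K & v' `\` w = (v `\` w) `\ K].
Proof.
move=> Cx ov ow vH nwH; have /finite_seqP[s sE] := orient_diff_finite Cx ov ow.
have sP L : L \in s <-> v L /\ ~ w L.
  by have /seteqP[sub sup] := sE; split; [exact: sup|exact: sub].
have [K Ks Kmin] := seq_min ((sP H).2 (conj vH nwH)).
have [vK nwK] := (sP K).1 Ks.
have [vHS vc vup vf] := ov; have [wHS wc wup wf] := ow.
have HK := vHS _ vK.
have vmin L : v L -> L `<=` K -> L = K.
  move=> vL LK; apply: Kmin => //; apply/sP; split=> // wL; apply: nwK.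
  exact: (wup L).
have cK : C `\` K <> K.
  by have [x Kx] := HS_neq0 HK => E; move: (Kx); rewrite -E => -[].
have nvcK := orient_cpl ov vK.
have ov' : orient ((v `\ K) `|` [set C `\` K]).
  split.
  - by move=> L [[/vHS//]|->]; exact: HS_cpl.
  - move=> L HL; have [->|LK] := pselect (L = K).
      by split=> [_ [[_ ]|/esym]//|_]; [apply|right].
    have [->|LcK] := pselect (L = C `\` K).
      rewrite cpl2//; split=> [[[_ []//]|/esym//]|[]]; by right.
    have cLK : C `\` L <> K by move=> E; apply: LcK; rewrite -E cpl2.
    have cLcK : C `\` L <> C `\` K by move=> E; apply: LK; rewrite -(cpl2 HL) E cpl2.
    split=> [[[/vc vcL _]|//] [[/vcL//]|//]|nL].
    by left; split=> //; apply/vc => // vL; apply: nL; left.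
  - move=> L M [[vL LK]|->] HM LM.
      have [ME|MK] := pselect (M = K); first by rewrite ME in LM; case: LK; exact: vmin.
      by left; split=> //; exact: (vup L).
    have [->|McK] := pselect (M = C `\` K); first by right.
    have [ME|MK] := pselect (M = K).
      have [x Kx] := HS_neq0 (HS_cpl HK); have := LM _ Kx; rewrite ME.
      by case: Kx.
    left; split=> //; apply: contrapT => nvM.
    have vcM : v (C `\` M) by apply/vc.
    have : C `\` M = K.
      apply: vmin => // x [Cx' nMx]; apply: contrapT => nKx; apply: nMx.
      by apply: LM; split.
    by move=> E; apply: McK; rewrite -E cpl2.
  - move=> x Cx'; apply: (@sub_finite_set _ _ ([set H | v H /\ ~ H x] `|` [set C `\` K])).
      by move=> L [[[vL _]|->] nLx]; [left|right].
    by rewrite finite_setU; split; [exact: vf|exact: finite_set1].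
exists ((v `\ K) `|` [set C `\` K]), K; split=> //.
  split=> //; apply/seteqP; split=> [L [vL nL]|_ ->].
    by apply: contrapT => LK; apply: nL; left.
  by split=> // -[[_ []]|/esym].
apply/seteqP; split=> [L [[[vL LK]|->] nwL]|L [[vL nwL] LK]].
- by [].
- by exfalso; apply: nwL; apply/wc.
- by split=> //; left.
Qed.

Lemma edgeP v w H : edge v w H ->
  [/\ HS H, v H, ~ w H, w (C `\` H) &
    (forall K, v K -> K <> H -> w K) /\ (forall K, w K -> K <> C `\` H -> v K)].
Proof.
move=> [ov ow /seteqP[vw wv]]; have [vH nwH] := wv H erefl.
have [vHS vc _ _] := ov; have [wHS wc _ _] := ow.
split=> //; [exact: vHS|by apply/wc => //; exact: vHS|split=> K].
  by move=> vK KH; apply: contrapT => nwK; apply: KH; exact: vw.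
move=> wK KH; apply: contrapT => nvK; have HK := wHS _ wK; apply: KH.
rewrite -(vw (C `\` K)) ?cpl2//; split; first exact/vc.
exact: (orient_cpl ow wK).
Qed.

Lemma edge_sym v w H : edge v w H -> edge w v (C `\` H).
Proof.
move=> e; have [HH vH nwH wcH [vw wv]] := edgeP e; have [ov ow _] := e.
split=> //; apply/seteqP; split=> [K [wK nvK]|_ ->].
  by apply: contrapT => KH; apply: nvK; exact: wv.
by split=> //; exact: orient_cpl vH.
Qed.

Lemma edge_inj v w w' H : edge v w H -> edge v w' H -> w = w'.
Proof.
move=> e e'; have [_ _ nwH wcH [vw wv]] := edgeP e; have [_ _ nwH' wcH' [vw' wv']] := edgeP e'.
apply/seteqP; split=> K KK.
  have [->//|KcH] := pselect (K = C `\` H).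
  by apply: vw' (wv _ KK KcH) _ => KH; apply: nwH; rewrite -KH.
have [->//|KcH] := pselect (K = C `\` H).
by apply: vw (wv' _ KK KcH) _ => KH; apply: nwH'; rewrite -KH.
Qed.

Lemma belowxx n v : below n v v.
Proof. by move=> H vH /(_ vH). Qed.

Lemma below_trans n v w u : below n v w -> below n w u -> below n v u.
Proof.
move=> vw wu H vH nuH; have [wH|nwH] := pselect (w H); first exact: wu.
exact: vw.
Qed.

Lemma below_sym n v w : orient v -> orient w -> below n v w -> below n w v.
Proof.
move=> ov ow vw H wH nvH; have HH : HS H by case: ow => + _ _ _; apply.
rewrite -col_cpl//; apply: vw; last exact: orient_cpl wH.
by have [_ vc _ _] := ov; apply/vc.
Qed.

Lemma below_le m n v w : (m <= n)%N -> below m v w -> below n v w.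
Proof. by move=> mn vw H vH nwH; apply: leq_trans mn; exact: vw. Qed.

Lemma edge_below v w H : edge v w H -> below (col H).+1 v w.
Proof.
move=> e K vK nwK; have [_ _ vw] := e.
by have -> : K = H by have : (v `\` w) K by []; rewrite vw.
Qed.

(* Half-spaces of one orientation meet pairwise; applied to the four ends, this
   gives the four corners. *)
Lemma hyperplane_ends_crossing v v' u u' H L : edge v v' H -> edge u u' H ->
  v L -> ~ u L -> crossing C H L.
Proof.
move=> e f vL nuL; have [HH vH nv'H v'cH [vv' v'v]] := edgeP e.
have [_ uH nu'H u'cH [uu' u'u]] := edgeP f.
have [ov ov' _] := e; have [ou ou' _] := f.
have LH : HS L by case: ov => + _ _ _; apply.
have ucL : u (C `\` L) by case: ou => _ uc _ _; exact/uc.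
split.
- exact: orient_meet vH vL.
- by have [x [Hx [_ nLx]]] := orient_meet ou uH ucL; exists x.
- have [|x [[_ nHx] Lx]] := orient_meet ov' v'cH (_ : v' L); last by exists x.
  by apply: vv' => // LE; apply: nuL; rewrite LE.
- have [|x [[Cx nHx] [_ nLx]]] := orient_meet ou' u'cH (_ : u' (C `\` L)); last by exists x.
  apply: uu' => // LE; apply: (orient_cpl ov vL); by rewrite LE.
Qed.

(** A separating wall with the colour of [H] would cross [H], but walls of one colour are nested.
    This drives the induction on colours. *)
Lemma same_side_below v v' u u' H : edge v v' H -> edge u u' H ->
  below (col H).+1 v u -> below (col H) v u.
Proof.
move=> e f vu L vL nuL; have := vu L vL nuL; rewrite ltnS leq_eqVlt => /predU1P[LH|//].
have [HH _ _ _ _] := edgeP e; have LS : HS L by case: e => -[+ _ _ _] _ _; apply.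
by case: (col_nested HH LS (esym LH)); exact: hyperplane_ends_crossing e f vL nuL.
Qed.

Lemma hend_edge v v' H : edge v v' H -> hend H v v.
Proof. by move=> e; split; [exists v'; left|exact: belowxx]. Qed.

(** With [hend_trans], this makes the candidate ends the same from either side of [H] and throughout
    the component, so the selection is well defined. *)
Lemma hend_sym v w H u : edge v w H -> hend H v u -> hend (C `\` H) w u.
Proof.
move=> e [[u' uu'] uv]; have [HH _ _ _ _] := edgeP e.
split; first by exists u'; rewrite cpl2//; case: uu'; [right|left].
rewrite col_cpl//; apply: below_trans uv _; exact: edge_below.
Qed.

Lemma hend_trans v v' u H : orient v -> orient v' -> below (col H).+1 v v' ->
  hend H v u -> hend H v' u.
Proof. by move=> ov ov' vv' [uu' uv]; split=> //; exact: below_trans vv'. Qed.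

Lemma sel_sym v w H u : edge v w H -> sel H v u -> sel (C `\` H) w u.
Proof.
move=> e [hu [i [iu imin]]]; have [HH _ _ _ _] := edgeP e.
split; first exact: hend_sym hu.
exists i; rewrite b_cpl//; split=> // j ji hj; apply: (imin j ji).
by have := hend_sym (edge_sym e) hj; rewrite cpl2.
Qed.

Lemma sel_trans v v' u H : orient v -> orient v' -> below (col H).+1 v v' ->
  sel H v u -> sel H v' u.
Proof.
move=> ov ov' vv' [hu [i [iu imin]]]; split; first exact: hend_trans hu.
exists i; split=> // j ji hj; apply: (imin j ji).
by apply: hend_trans hj => //; exact: below_sym.
Qed.

Lemma sel_inj H v u u' : sel H v u -> sel H v u' -> u = u'.
Proof.
move=> [hu [i [iu imin]]] [hu' [j [ju' jmin]]].
have [ij|ji|ij] := ltngtP i j.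
- by case: (jmin i ij); rewrite iu.
- by case: (imin j ji); rewrite ju'.
- by rewrite -iu -ju' ij.
Qed.

Lemma tree_sym v w : tree v w -> tree w v.
Proof.
move=> [H [e vw]]; exists (C `\` H); split; first exact: edge_sym.
by case: vw => /(sel_sym e); [right|left].
Qed.

Lemma tree_orient v w : tree v w -> orient v /\ orient w.
Proof. by move=> [H [[]]]. Qed.

Lemma tree_exists v w H : edge v w H -> exists v' w',
  [/\ edge v' w' H, tree v' w' & below (col H).+1 v v'].
Proof.
move=> e; have [ov ow _] := e; have [HH _ _ _ _] := edgeP e.
pose P i := `[< hend H v (dec i (b H)) >].
have exP : exists i, P i.
  have [i iv] := dec_surj (b_in HH) ov.
  by exists i; apply/asboolP; rewrite iv; exact: hend_edge e.
have [i /asboolP hi imin] := ex_minnP exP.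
have si : sel H v (dec i (b H)).
  split=> //; exists i; split=> // j ji hj.
  by have := imin j (asboolT hj); rewrite leqNgt ji.
(* The selected end may lie on either side of the hyperplane. *)
have [[u' [f|f]] uv] := hi.
  have [ou ou' _] := f; exists (dec i (b H)), u'; split=> //.
    by exists H; split=> //; left; apply: sel_trans si => //; exact: below_sym.
  exact: below_sym.
have [ou ou' _] := f; exists u', (dec i (b H)).
have f' : edge u' (dec i (b H)) H by have := edge_sym f; rewrite cpl2.
have vu' : below (col H).+1 v u'.
  apply: below_trans (below_sym ou ov uv) _.
  by apply: below_sym => //; exact: edge_below.
split=> //; exists H; split=> //; right; exact: sel_trans si.
Qed.

(** The selected end is the same throughout a component, and its neighbour across the hyperplane is
    determined. *)
Lemma tree_unique v w v' w' H : tree v w -> tree v' w' -> edge v w H -> edge v' w' H ->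
  below (col H).+1 v v' -> v = v' /\ w = w'.
Proof.
have edge_lab x y K K' : edge x y K -> edge x y K' -> K = K'.
  by move=> [_ _ E] [_ _ E']; suff : [set K'] K by []; rewrite -E' E.
move=> [K [eK sK]] [K' [eK' sK']] e e' vv'.
have EK := edge_lab _ _ _ _ eK e; have EK' := edge_lab _ _ _ _ eK' e'; subst K K'.
have [ov ow _] := e; have [ov' ow' _] := e'.
have {}sK' : sel H v v' \/ sel H v w'.
  by case: sK' => h; [left|right]; apply: sel_trans h => //; exact: below_sym.
have [_ vH nwH _ _] := edgeP e; have [_ v'H nw'H _ _] := edgeP e'.
case: sK sK' => h [h'|h']; have E := sel_inj h h'.
- by split=> //; apply: edge_inj e _; rewrite E.
- by case: nw'H; rewrite -E.
- by case: nwH; rewrite E.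
- split=> //; rewrite -E in e'; apply: (edge_inj (edge_sym e)); exact: edge_sym.
Qed.

(** * The selected edges form a spanning tree *)

Lemma walk_cat k l v w u : wlk k v w -> wlk l w u -> wlk (k + l) v u.
Proof. elim: k v => [v ->//|k IH v [x [vx xw]] wu]; rewrite addSn; exists x; split=> //; exact: IH xw wu. Qed.

Definition connected_vertices v w := exists k, wlk k v w.

Lemma connected_vertices_trans v w u :
  connected_vertices v w -> connected_vertices w u -> connected_vertices v u.
Proof. by move=> [k vw] [l wu]; exists (k + l)%N; exact: walk_cat wu. Qed.

(** Outer induction on the colour bound, inner on the length of a list holding the separating walls.
    To cross the next wall [K], go to its tree edge in the component and come back on the other
    side; by [same_side_below] both trips use colours below that of [K]. *)
Lemma connected_vertices_below x0 n v w : C x0 -> orient v -> orient w -> below n v w ->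
  connected_vertices v w.
Proof.
move=> Cx; elim: n v w => [|n IHn] v w ov ow vw.
  exists 0%N; have vsub : v `<=` w.
    by move=> H vH; apply: contrapT => nwH; have := vw H vH nwH.
  apply/seteqP; split=> // H wH; apply: contrapT => nvH.
  have [vHS vc _ _] := ov; have HH : HS H by case: ow => + _ _ _; apply.
  by apply: (orient_cpl ow wH); apply: vsub; apply/vc.
have /finite_seqP[s sE] := orient_diff_finite Cx ov ow.
have {sE} : v `\` w `<=` [set` s] by rewrite sE.
move: {2}(size s) (leqnn (size s)) => m; elim: m v s ov vw => [|m IHm] v s ov vw sm sE.
  have vw0 : below 0 v w.
    by move=> H vH nwH; have := sE H (conj vH nwH); move: sm; case: (s).
  exact: IHn (below_le (leq0n n) vw0).
have [[H [vH nwH]]|vw0] := pselect (exists H, v H /\ ~ w H); last first.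
  apply: IHn => // H vH nwH; case: vw0; by exists H.
have [v' [K [e vK nwK vE]]] := flip_step Cx ov ow vH nwH.
have [_ ov' _] := e; have [HK _ _ _ _] := edgeP e.
apply: (@connected_vertices_trans _ v').
  have [u [u' [f uu' vu]]] := tree_exists e.
  have [ou ou' _] := f.
  have Kn : (col K <= n)%N by rewrite -ltnS; exact: vw.
  apply: connected_vertices_trans (IHn v u ov ou _) _.
    by apply: (below_le Kn); exact: same_side_below e f vu.
  apply: connected_vertices_trans; first by exists 1%N, u'; split.
  apply: IHn => //; apply: (below_le Kn).
  have cK : col K = col (C `\` K) by rewrite col_cpl.
  rewrite cK; apply: (same_side_below (edge_sym f) (edge_sym e)).
  rewrite -cK; apply: below_trans (below_sym ou ou' (edge_below f)) _.
  by apply: below_trans (below_sym ov ou vu) _; exact: edge_below.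
have Ks : K \in s by exact: sE.
apply: (IHm v' (rem K s)) => //.
- move=> L v'L nwL; have : (v' `\` w) L by [].
  by rewrite vE => -[[vL _] _]; exact: vw.
- by rewrite size_rem// -ltnS prednK//; case: (s) Ks.
- rewrite vE => L [vwL LK]; have /= := sE L vwL.
  by apply: rem_mem; apply/eqP.
Qed.

Lemma orient_connected x0 v w : C x0 -> orient v -> orient w -> connected_vertices v w.
Proof.
move=> Cx ov ow; have /finite_seqP[s sE] := orient_diff_finite Cx ov ow.
apply: (@connected_vertices_below x0 (\max_(H <- s) (col H).+1)%N) => // H vH nwH.
have Hs : H \in s by have /seteqP[+ _] := sE; apply.
exact: (@leq_bigmax_seq _ s xpredT (fun H => (col H).+1) H Hs isT).
Qed.

Let step v w := `[< tree v w >].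
Let lab v w := xget set0 [set H | edge v w H].

Let labP v w : tree v w -> edge v w (lab v w).
Proof. by move=> [H [e _]]; exact: (@xgetI _ set0 [set H | edge v w H] H e). Qed.

Lemma path_below a s n : orient a -> path step a s ->
  path (fun u v => (col (lab u v) <= n)%N) a s ->
  forall u, u \in a :: s -> orient u /\ below n.+1 a u.
Proof.
elim: s a => [|c s IH] a oa /=.
  by move=> _ _ u; rewrite inE => /eqP->; split=> //; exact: belowxx.
move=> /andP[/asboolP ac cs] /andP[nac ncs] u; rewrite inE => /predU1P[->|].
  by split=> //; exact: belowxx.
have [_ oc] := tree_orient ac.
move=> /(IH c oc cs ncs)[ou cu]; split=> //; apply: below_trans cu.
by apply: below_le (edge_below (labP ac)).
Qed.

Lemma edge_agree v w H K : edge v w H -> K <> H -> K <> C `\` H -> v K <-> w K.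
Proof.
move=> e KH KcH; have [_ _ _ _ [vw wv]] := edgeP e.
by split=> [vK|wK]; [exact: vw|exact: wv].
Qed.

(* An edge of maximal colour on a simple path is the only edge of the path in
   its hyperplane, because the path stays in one class of that colour. *)
Lemma tree_no_detour a c s : tree a c -> path step a s -> last a s = c -> uniq (a :: s) ->
  s = [:: c].
Proof.
move=> ac as_ sc us.
have eac := labP ac; set H := lab a c in eac.
have [HH aH ncH cH _] := edgeP eac; have [oa oc] := tree_orient ac.
have s0 : s != [::] by apply/eqP => s0; move: sc; rewrite s0 /= => ac'; apply: ncH; rewrite -ac'.
have [s1 [y [s2 [sE smax]]]] := path_max (fun u v => col (lab u v)) a s0.
have below_s := path_below oa as_ smax.
set x := last a s1 in smax below_s.
have xs1 : x \in a :: s1 by exact: mem_last.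
have := us; rewrite sE -cat_cons cat_uniq => /and3P[us1 dis us2].
have nin p : p \in a :: s1 -> p \in y :: s2 -> False.
  by move=> p1 p2; move/hasPn: dis => /(_ _ p2) /negP; apply.
have in1 p : p \in a :: s1 -> p \in a :: s by rewrite sE -cat_cons mem_cat => ->.
have in2 p : p \in y :: s2 -> p \in a :: s by rewrite sE -cat_cons mem_cat orbC => ->.
have := as_; rewrite sE cat_path /= -/x => /and3P[as1 /asboolP xy ys2].
have exy := labP xy; set L := lab x y in exy smax below_s.
have [HL xL nyL _ _] := edgeP exy.
have uniqL p q : p \in a :: s -> tree p q -> edge p q L -> p = x /\ q = y.
  move=> ps pq epq; have [op ap] := below_s _ ps; have [ox ax] := below_s _ (in1 _ xs1).
  have xp : below (col L).+1 x p by apply: below_trans ap; exact: below_sym.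
  by have [-> ->] := tree_unique xy pq exy epq xp.
have cs2 : last y s2 = c by rewrite -sc sE last_cat.
have cy : c \in y :: s2 by rewrite -cs2 mem_last.
have enter p q : ~ p L -> q L -> tree p q -> edge q p L.
  move=> npL qL pq; have epq := labP pq; have [HK _ _ _ _] := edgeP epq.
  have [_ _ qp] := edge_sym epq.
  have LE : L = C `\` lab p q by suff : [set C `\` lab p q] L by []; rewrite -qp.
  by rewrite LE; exact: edge_sym.
(* Here [x] is [a] and [y] is [c], and simplicity of the path leaves this edge alone. *)
have [LH|LH] := pselect (L = H).
  have [xa yc] : a = x /\ c = y by apply: uniqL => //; [exact: mem_head|rewrite LH].
  have s10 : s1 = [::].
    have xa' : last a s1 = a := esym xa.
    case/lastP: (s1) us1 xa' => // t z; rewrite last_rcons => + za.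
    by rewrite /= za mem_rcons mem_head.
  have s20 : s2 = [::].
    case/lastP: (s2) us2 cs2 => // t z; rewrite last_rcons -yc => + zc.
    by rewrite /= zc mem_rcons mem_head.
  by rewrite s10 s20 yc.
have [LcH|LcH] := pselect (L = C `\` H).
  have [_ ya] : c = x /\ a = y.
    apply: uniqL; [exact: in2|exact: tree_sym|rewrite LcH; exact: edge_sym].
  by case: (nin a); rewrite ?mem_head// ya mem_head.
(* Now [L] does not separate [a] from [c], so the path, having crossed it, must cross it a second
   time. *)
have acL := edge_agree eac LH LcH.
have [aL|naL] := pselect (a L).
  have cL : c L by apply/acL.
  have [|p [q [_ qs2 /asboolP pq npL /contrapT qL]]] := @path_enter _ step (fun u => ~ u L) y s2 ys2 nyL.
    by rewrite cs2; apply.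
  have qs : q \in y :: s2 by rewrite inE qs2 orbT.
  have [qx _] := uniqL q p (in2 _ qs) (tree_sym pq) (enter _ _ npL qL pq).
  by case: (nin q) => //; rewrite qx.
have [|p [q [ps1 qs1 /asboolP pq npL /contrapT qL]]] := @path_enter _ step (fun u => ~ u L) a s1 as1 naL.
  by apply.
have qs : q \in a :: s1 by rewrite inE qs1 orbT.
have [_ py] := uniqL q p (in1 _ qs) (tree_sym pq) (enter _ _ npL qL pq).
by case: (nin p) => //; rewrite py mem_head.
Qed.

Definition bypass a c u v := `[< tree u v /\ ~ (u = a /\ v = c) /\ ~ (u = c /\ v = a) >].

(** The side of [a] is what is reachable without the edge; [tree_no_detour] keeps [c] out.
    Acyclicity is recorded through sides because these survive the contraction. *)
Lemma tree_side a c : tree a c -> exists A : set (set (set T)),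
  [/\ A a, ~ A c & forall u v, tree u v -> A u -> ~ A v -> u = a /\ v = c].
Proof.
move=> ac; exists [set u | exists2 s, path (bypass a c) a s & last a s = u].
split; first by exists [::].
  case=> s sp sl; case/shortenP: sp sl => s' sp' us' _ sl.
  have sT : path step a s'.
    by apply: (sub_path _ sp') => u v /asboolP[uv _]; exact/asboolP.
  have sE := tree_no_detour ac sT sl us'.
  by move: sp'; rewrite sE /= => /andP[/asboolP[_ [+ _]]]; case.
move=> u v uv [s sp su] nv; apply: contrapT => nuv; apply: nv.
have [[uc va]|nvu] := pselect (u = c /\ v = a); first by exists [::].
exists (rcons s v); last by rewrite last_rcons.
by rewrite rcons_path sp su; apply/asboolP.
Qed.

(** * Contraction of the spanning tree onto the points *)

Lemma walk_diff k v w x0 : C x0 -> orient v -> orient w -> wlk k v w ->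
  exists s : seq (set T), (size s <= k)%N /\ forall H, v H -> ~ w H -> H \in s.
Proof.
move=> Cx; elim: k v => [|k IH] v ov ow.
  by move=> <-; exists [::]; split=> // H vH /(_ vH).
case=> u [vu uw]; have [_ ou] := tree_orient vu; have e := labP vu.
have [s [sk sP]] := IH u ou ow uw; exists (lab v u :: s); split=> //= H vH nwH.
rewrite inE; have [uH|nuH] := pselect (u H); first by rewrite sP ?orbT.
have [_ _ E] := e; apply/orP; left; apply/eqP.
by suff : [set lab v u] H by []; rewrite -E.
Qed.

(** The walls between [x0] and a point [k] steps from [v] number at most those between [x0] and [v]
    plus [k], which [HS_proper] forbids on an infinite set. *)
Lemma walk_ball_finite k v x0 : C x0 -> orient v ->
  finite_set [set y | walk_to_point C HS col b dec k v y].
Proof.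
move=> Cx ov; apply: contrapT => inf.
have /finite_seqP[s0 s0E] := orient_diff_finite Cx ov (orient_principal Cx).
have s0P H : v H -> ~ H x0 -> H \in s0.
  by move=> vH nHx; have /seteqP[+ _] := s0E; apply; split=> // -[].
have [|y [Cy vy] [s [us ss sP]]] := HS_proper (size s0 + k).+1 _ inf Cx; first by move=> y [].
have [t [tk tP]] := walk_diff Cx ov (orient_principal Cy) vy.
suff : (size s <= size (s0 ++ map (fun H => C `\` H) t))%N.
  by rewrite ss size_cat size_map ltnNge leq_add2l tk.
apply: uniq_leq_size us _ => H /sP[HH Hy nHx]; rewrite mem_cat.
have [vH|nvH] := pselect (v H); first by rewrite s0P.
apply/orP; right; apply/mapP; exists (C `\` H); last by rewrite cpl2.
by apply: tP; [case: ov => _ vc _ _; exact/vc|case=> _ []].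
Qed.

Lemma nearest_exists v x0 : C x0 -> orient v -> exists x, near v x.
Proof.
move=> Cx ov; pose P k := `[< exists x, walk_to_point C HS col b dec k v x >].
have exP : exists k, P k.
  have [k vx] := orient_connected Cx ov (orient_principal Cx).
  by exists k; apply/asboolP; exists x0.
have [k /asboolP[x vx] kmin] := ex_minnP exP.
have [y vy yle] := le_min (walk_ball_finite k Cx ov) (ex_intro _ x vx).
exists y, k; split=> // j z jk vz; have := kmin j (asboolT (ex_intro _ z vz)).
by rewrite leqNgt jk.
Qed.

Lemma nearest_unique v x y : near v x -> near v y -> x = y.
Proof.
move=> [k [vx xmin xle]] [l [vy ymin yle]].
have [kl|lk|kl] := ltngtP k l; first by case: (ymin _ _ kl vx).
  by case: (xmin _ _ lk vy).
by subst l; apply: le_anti; [exact: xle|exact: yle].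
Qed.

Lemma nearest_in v x : near v x -> C x.
Proof. by move=> [k [[]]]. Qed.

(** Points with equal principal orientations are equally far from [v], so the order favours the same
    one at every distance. *)
Lemma nearest_principal v x : near v x -> near (pr x) x.
Proof.
move=> [k [[Cx vx] xmin xle]]; exists 0%N; split=> // y [Cy /= xy].
by apply: xle; split=> //; rewrite -xy.
Qed.

Lemma principal_nearest x y : C x -> near (pr x) y -> pr x = pr y.
Proof. by move=> Cx [[|k] [[Cy xy] xmin _]] //; case: (xmin 0%N x). Qed.

(** A competitor for [u] at distance [j] competes for [v] at distance [j.+1]. *)
Lemma nearest_step k v x : nearest_at C HS col b dec le k.+1 v x ->
  exists u, tree v u /\ nearest_at C HS col b dec le k u x.
Proof.
move=> [[Cx [u [vu ux]]] xmin xle]; exists u; split=> //.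
split=> // [j y jk [Cy uy]|y [Cy uy]].
  by apply: (xmin j.+1 y) => //; split=> //; exists u.
by apply: xle; split=> //; exists u.
Qed.

(** The only edge leaving [A] joins two different cells, so a shortest walk from [v] to its nearest
    point stays on one side. *)
Lemma fibre_side a c x y A : near a x -> near c y -> x <> y ->
  (forall u v, tree u v -> A u -> ~ A v -> u = a /\ v = c) ->
  forall v z, near v z -> A v <-> A (pr z).
Proof.
move=> ax cy xy Aac v z [k]; elim: k v => [|k IH] v vz.
  by have [[_ /= <-]] := vz.
have [u [vu uz]] := nearest_step vz; rewrite -(IH u uz).
have {}vz : near v z by exists k.+1.
have {}uz : near u z by exists k.
split=> [Av|Au]; apply: contrapT => nA; case: xy.
  have [va uc] := Aac _ _ vu Av nA; subst v u.
  by rewrite -(nearest_unique vz ax); exact: nearest_unique uz cy.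
have [ua vc] := Aac _ _ (tree_sym vu) Au nA; subst v u.
by rewrite -(nearest_unique uz ax); exact: nearest_unique vz cy.
Qed.

Local Notation ptree := (point_tree C HS col b dec le).

Lemma point_tree_sym x y : ptree x y -> ptree y x.
Proof.
move=> [Cx Cy xy h]; split=> //; first exact/nesym.
case: h => [h|h|[v [w [vw vx wy]]]]; [exact: Or32|exact: Or31|apply: Or33].
by exists w, v; split=> //; exact: tree_sym.
Qed.

Lemma point_tree_side x y : ptree x y -> exists A : set T,
  [/\ A x, ~ A y & forall x' y', ptree x' y' -> A x' -> ~ A y' -> x' = x /\ y' = y].
Proof.
(* A point not nearest to its own principal orientation has a single neighbour. *)
have leaf p q : C p -> p <> q -> near (pr p) q -> forall z, ptree p z -> z = q.
  move=> Cp pq pq' z [_ Cz pz [h|h|[v [w [_ vp _]]]]].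
  - exact: nearest_unique h pq'.
  - case: pq; apply: nearest_unique pq'; rewrite -(principal_nearest Cz h).
    exact: h.
  - by case: pq; apply: nearest_unique (nearest_principal vp) pq'.
move=> [Cx Cy xy [h|h|[v [w [vw vx wy]]]]].
- exists [set x]; split=> //; first exact: nesym.
  move=> x' y' xy' x'x _; split=> //; apply: (leaf x y) => //.
  by rewrite -x'x.
- exists (~` [set y]); split=> //; first by apply.
  move=> x' y' xy' _ /contrapT y'y; split=> //.
  by apply: (leaf y x) => //; [exact/nesym|apply: point_tree_sym; rewrite -y'y].
- have [A [Av nAw Avw]] := tree_side vw.
  have AE := fibre_side vx wy xy Avw.
  exists [set z | A (pr z)]; split; [exact: (AE _ _ vx).1|by move=> h; apply/nAw/((AE _ _ wy).2 h)|].
  move=> x' y' [Cx' Cy' _ [h|h|[v' [w' [vw' vx' wy']]]]] /= Ax' nAy'.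
  + by case: nAy'; rewrite -(principal_nearest Cx' h).
  + by case: nAy'; rewrite (principal_nearest Cy' h).
  + have [vE wE] := Avw _ _ vw' ((AE _ _ vx').2 Ax') (fun h => nAy' ((AE _ _ wy').1 h)).
    subst v' w'; split; [exact: nearest_unique vx' vx|exact: nearest_unique wy' wy].
Qed.

Let pstep x y := `[< ptree x y >].

(** A walk of the median tree is projected by [nearest]: consecutive vertices have equal or adjacent
    nearest points. *)
Lemma point_tree_connected x y : C x -> C y ->
  exists2 s, path (fun x y => `[< ptree x y >]) x s & last x s = y.
Proof.
move=> Cx Cy.
have pc_trans p q z : (exists2 s, path pstep p s & last p s = q) ->
    (exists2 s, path pstep q s & last q s = z) -> exists2 s, path pstep p s & last p s = z.
  move=> [s ps sq] [t qt tz]; exists (s ++ t); first by rewrite cat_path ps sq.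
  by rewrite last_cat sq.
have pc_edge p q : p = q \/ ptree p q -> exists2 s, path pstep p s & last p s = q.
  case=> [->|pq]; first by exists [::].
  by exists [:: q] => //=; rewrite andbT; exact/asboolP.
have pc_near p q : C p -> near (pr p) q -> exists2 s, path pstep p s & last p s = q.
  move=> Cp pq; apply: pc_edge; have [->|pq'] := pselect (p = q); first by left.
  by right; split=> //; [exact: nearest_in pq|exact: Or31].
have pc_near' p q : C p -> near (pr p) q -> exists2 s, path pstep q s & last q s = p.
  move=> Cp pq; apply: pc_edge; have [->|pq'] := pselect (q = p); first by left.
  by right; split=> //; [exact: nearest_in pq|exact: Or32].
have ox := orient_principal Cx; have oy := orient_principal Cy.
have [k xy] := orient_connected Cx ox oy.
have [x' xx'] := nearest_exists Cx ox; have [y' yy'] := nearest_exists Cx oy.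
have walk_path v z : wlk k v (pr y) -> near v z -> exists2 s, path pstep z s & last z s = y'.
  elim: k v z {xy} => [|k IH] v z; first by move=> /= -> /nearest_unique/(_ yy') ->; exists [::].
  case=> u [vu uy] vz; have [_ ou] := tree_orient vu.
  have [t ut] := nearest_exists Cy ou; apply: (pc_trans _ t); last exact: IH uy ut.
  apply: pc_edge; have [->|zt] := pselect (z = t); first by left.
  right; split=> //; [exact: nearest_in vz|exact: nearest_in ut|apply: Or33].
  by exists v, u.
apply: (pc_trans _ x'); first exact: pc_near.
apply: (pc_trans _ y'); last exact: pc_near'.
exact: walk_path xy xx'.
Qed.

End Orientations.

(* Each edge of the graph is the only one leaving some vertex set, so a cycle
   through it would traverse it twice. *)
Lemma acyclic_of_sides (T : choiceType) (G : set (T * T)) :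
  (forall x y, G (x, y) -> exists A : set T, [/\ A x, ~ A y &
     forall x' y', G (x', y') -> A x' -> ~ A y' -> x' = x /\ y' = y]) ->
  (forall x y, G (x, y) -> G (y, x)) -> acyclic G.
Proof.
move=> Gside Gsym [|x [|y [|z s]]] // _ /andP[].
rewrite /cycle rcons_path /= => /andP[/and3P[/asboolP xy yz zs] lx].
rewrite !inE !negb_or => /andP[/and3P[xny xnz xns] /andP[/andP[ynz yns] _]].
have [A [Ax nAy Axy]] := Gside _ _ xy.
have [Az|nAz] := pselect (A z).
  have [zx _] := Axy _ _ (Gsym _ _ (asboolW yz)) Az nAy.
  by rewrite zx eqxx in xnz.
have zsx : path (adj G) z (rcons s x) by rewrite rcons_path zs.
have [|p [q [ps qs /asboolP pq nAp /contrapT Aq]]] :=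
    @path_enter _ (adj G) (fun u => ~ A u) z (rcons s x) zsx nAz.
  by rewrite last_rcons; apply.
have [_ py] := Axy _ _ (Gsym _ _ pq) Aq nAp.
move: ps; rewrite py inE mem_rcons inE (negbTE ynz) (negbTE yns) eq_sym.
by rewrite (negbTE xny).
Qed.

(** * Codes and colours of half-spaces *)

Definition lex_le (X : Type) (iota : X -> cantor) (x y : X) :=
  x = y \/ exists n, [/\ agree n (iota x) (iota y), ~~ iota x n & iota y n].

Section LexOrder.
Variables (X : choiceType) (iota : X -> cantor).
Hypothesis iota_inj : injective iota.
Local Notation le := (lex_le iota).

Lemma lex_le_anti x y : le x y -> le y x -> x = y.
Proof.
move=> [//|[n [xy nx ny]]] [//|[m [yx my mx]]].
have [nm|mn|nm] := ltngtP n m.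
- by move: nx; rewrite -yx// ny.
- by move: my; rewrite -xy// mx.
- by move: nx; rewrite nm mx.
Qed.

Lemma lex_le_total x y : le x y \/ le y x.
Proof.
have [->|xy] := pselect (x = y); first by left; left.
have ex : exists n, iota x n != iota y n.
  apply: contrapT => /forallNP n; apply/xy/iota_inj/funext => i.
  by have /negP := n i; rewrite negbK => /eqP.
have [n xyn nmin] := ex_minnP ex.
have ag : agree n (iota x) (iota y).
  move=> i ni; apply/eqP; apply: contraTT ni => /nmin.
  by rewrite -leqNgt.
case xn : (iota x n); case yn : (iota y n); rewrite xn yn// in xyn.
  by right; right; exists n; rewrite xn yn; split=> // i /ag.
by left; right; exists n; rewrite xn yn.
Qed.

Lemma lex_le_trans x y z : le x y -> le y z -> le x z.
Proof.
move=> [->//|[n [xy nx ny]]] [<-|[m [yz my mz]]]; first by right; exists n.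
right; have [nm|mn|nm] := ltngtP n m.
- exists n; split=> //; last by rewrite -yz.
  by move=> i ni; rewrite xy// yz// (ltn_trans ni).
- exists m; split=> //; last by rewrite xy.
  by move=> i mi; rewrite xy ?yz// (ltn_trans mi).
- by move: my; rewrite -nm ny.
Qed.

Lemma lex_le_min (A : set X) : finite_set A -> A !=set0 ->
  exists2 x, A x & forall y, A y -> le x y.
Proof.
move=> /finite_seqP[s ->]; elim: s => [[x//]|x s IH _].
have [/IH[y ys yle]|s0] := pselect ([set` s] !=set0); last first.
  exists x => [|y]; rewrite /= ?mem_head// inE => /predU1P[->|ys]; first by left.
  by case: s0; exists y.
have [xy|yx] := lex_le_total x y.
  exists x => [|z]; rewrite /= ?mem_head// inE => /predU1P[->|/yle]; first by left.
  exact: lex_le_trans.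
exists y => [|z]; rewrite /= inE; first by apply/orP; right.
by move=> /predU1P[->//|/yle].
Qed.

End LexOrder.

(** * Measurable predicates and countable quantifiers *)

Section Measurability.
Context {d : measure_display} {X : measurableType d}.
Implicit Types P Q : X -> Prop.

Definition mea P := measurable [set x | P x].

Lemma mea_ext P Q : (forall x, P x <-> Q x) -> mea P -> mea Q.
Proof.
by move=> PQ; rewrite /mea (_ : mkset P = mkset Q)//; apply/seteqP; split=> x /PQ.
Qed.

Lemma mea_cst (p : Prop) : mea (fun=> p).
Proof.
have [h|h] := pselect p.
  by apply: (@mea_ext (fun=> True)) => //; exact: measurableT.
by apply: (@mea_ext (fun=> False)) => //; exact: measurable0.
Qed.

Lemma mea_not P : mea P -> mea (fun x => ~ P x).
Proof. exact: measurableC. Qed.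

Lemma mea_and P Q : mea P -> mea Q -> mea (fun x => P x /\ Q x).
Proof. exact: measurableI. Qed.

Lemma mea_or P Q : mea P -> mea Q -> mea (fun x => P x \/ Q x).
Proof. exact: measurableU. Qed.

Lemma mea_imp P Q : mea P -> mea Q -> mea (fun x => P x -> Q x).
Proof.
move=> mP mQ; apply: (@mea_ext (fun x => ~ P x \/ Q x)); last exact/mea_or/mQ/mea_not.
by move=> x; split=> [[nP /nP|//]//|PQ]; have [/PQ|] := pselect (P x); [right|left].
Qed.

Lemma mea_iff P Q : mea P -> mea Q -> mea (fun x => P x <-> Q x).
Proof. by move=> mP mQ; apply: mea_and; exact: mea_imp. Qed.

Lemma mea_ex (I : countType) (P : I -> X -> Prop) :
  (forall i, mea (P i)) -> mea (fun x => exists i, P i x).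
Proof.
move=> mP; apply: (@mea_ext (fun x => (\bigcup_n [set x |
    if unpickle n is Some i then P i x else False]) x)).
  move=> x; split=> [[n _ /=]|[i Pi]]; first by case: unpickle => // i Pi; exists i.
  by exists (pickle i) => //=; rewrite pickleK.
apply: bigcupT_measurable => n; case: unpickle => [i|]; [exact: mP|exact: (mea_cst False)].
Qed.

Lemma mea_all (I : countType) (P : I -> X -> Prop) :
  (forall i, mea (P i)) -> mea (fun x => forall i, P i x).
Proof.
move=> mP; apply: (@mea_ext (fun x => ~ exists i, ~ P i x)).
  move=> x; split=> [nP i|Pi [i]]; last by apply.
  by apply: contrapT => nPi; apply: nP; exists i.
by apply/mea_not/mea_ex => i; exact/mea_not.
Qed.

Lemma mea_comp P (a : X -> X) : measurable_fun setT a -> mea P -> mea (fun x => P (a x)).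
Proof. by move=> ma mP; have := ma measurableT _ mP; rewrite setTI. Qed.

End Measurability.

(** * Connectedness classes *)

Section Classes.
Variables (T : choiceType) (G : set (T * T)).
Hypothesis Gsym : forall x y, G (x, y) -> G (y, x).

Definition cls (x : T) : set T := xsection (connectedness G) x.
Definition cls_graph (C : set T) := induced_graph G C.

Lemma clsP x y : cls x y <-> connectedness G (x, y).
Proof. by rewrite /cls xsectionE. Qed.

Lemma cls_refl x : cls x x.
Proof. by apply/clsP; exists [::]. Qed.

Lemma cls_trans x y z : cls x y -> cls y z -> cls x z.
Proof.
move=> /clsP[s /= xs sy] /clsP[t /= yt tz]; apply/clsP; exists (s ++ t) => /=.
  by rewrite cat_path xs sy.
by rewrite last_cat sy.
Qed.

Lemma cls_edge x y : G (x, y) -> cls x y.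
Proof. by move=> xy; apply/clsP; exists [:: y] => //=; rewrite andbT; apply/asboolP. Qed.

Lemma cls_sym x y : cls x y -> cls y x.
Proof.
move=> /clsP[s /= xs <-]; elim: s x xs => [x _|z s IH x /= /andP[/asboolP xz zs]].
  exact: cls_refl.
by apply: cls_trans (IH z zs) _; exact/cls_edge/Gsym.
Qed.

Lemma cls_eq x y : cls x y -> cls y = cls x.
Proof.
move=> xy; apply/seteqP; split=> z h; first exact: cls_trans h.
by apply: cls_trans h; exact: cls_sym.
Qed.

Lemma cls_graph_sub C : cls_graph C `<=` C `*` C.
Proof. by move=> p []. Qed.

Lemma cls_graph_sym C x y : cls_graph C (x, y) -> cls_graph C (y, x).
Proof. by move=> [/Gsym xy [/= Cx Cy]]. Qed.

Lemma cls_graph_connected x : connected_on (cls_graph (cls x)) (cls x).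
Proof.
move=> [y z] [/= xy xz]; have /clsP[s /= ys sz] := cls_trans (cls_sym xy) xz.
exists s => //=; elim: s y xy ys {sz} => //= u s IH y xy /andP[/asboolP yu us].
have xu : cls x u by apply: cls_trans xy _; exact: cls_edge.
by rewrite IH// andbT; apply/asboolP.
Qed.

Lemma cls_graph_lf C : locally_finite G -> locally_finite (cls_graph C).
Proof.
move=> lf x; apply: sub_finite_set (lf x) => y.
by rewrite !xsectionE => -[].
Qed.

Lemma components_cls x : components G (cls x).
Proof. by exists x. Qed.

End Classes.

Section Codes.
Variables (T : choiceType) (G : set (T * T)) (HH : set T -> set (set T)).
Variables (e : nat -> T -> T) (iota : T -> cantor) (x0 : T).
Implicit Types (C H K : set T) (x y : T).

Local Notation cls := (cls G).
Local Notation code := (seq (nat * nat)).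

Definition hsp C : set (set T) := [set H | HH C H /\ H <> set0 /\ H <> C].

Definition code_edges (c : code) x := [seq (e p.1 x, e p.2 x) | p <- c].

(** The code names boundary edges by indices of the enumeration from [x]. An invalid code yields the
    trivial [set0], so [hsp] of the value tests validity. *)
Definition hs (c : code) x : set T := xget set0 [set H | hsp (cls x) H /\
  inward_ebd (cls x) (induced_graph G (cls x)) H = [set` code_edges c x]].

(* The orientation obtained from the principal one at [x] by reversing the walls
   coded by [l]. *)
Definition vt (l : seq code) x : set (set T) := [set H | hsp (cls x) H /\
  ~ (H x <-> exists2 c, c \in l & H = hs c x \/ H = cls x `\` hs c x)].

Definition vt_dec (i : nat) x := vt (odflt [::] (unpickle i)) x.

(** The boundary of a half-space is finite and shared with its complement, so the base point exists
    and belongs to the wall. *)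
Definition is_base C H y := vbd C (induced_graph G C) H y /\
  forall z, vbd C (induced_graph G C) H z -> lex_le iota y z.

Definition base C H := xget x0 [set y | is_base C H y].

(* A half-space is determined by its base point and a code relative to it;
   [side_code] asks for a given code and a given approximation of the base
   point.  Walls crossing each other are separated by such data, so the least
   [n] with [fam C n H] is a colouring. *)
Definition side_code C (n : nat) H :=
  let: (s, c) := odflt ([::], [::]) (unpickle n : option (seq bool * code)) in
  agree (size s) (iota (base C H)) (nth false s) /\ hs c (base C H) = H.

Definition wall_code C n H := side_code C n H \/ side_code C n (C `\` H).

Definition fam C n H := wall_code C n H /\
  forall K, hsp C K -> crossing C H K -> ~ wall_code C n K.

Definition colour C H := xget 0 [set n | fam C n H /\ forall m, (m < n)%N -> ~ fam C m H].

End Codes.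

Lemma crossing_cpl (T : Type) (C H K : set T) : H `<=` C -> K `<=` C ->
  crossing C H K -> crossing C (C `\` H) K.
Proof.
move=> HC KC [[x [Hx Kx]] [y [Hy nKy]] [z [nHz Kz]] [w [Cw nHw nKw]]]; split.
- by exists z; split=> //; split=> //; exact: KC.
- by exists w.
- by exists x; split=> // -[].
- by exists y; split=> // [|[]//]; exact: HC.
Qed.

Section ClassFacts.
Variables (T : choiceType) (G : set (T * T)) (HH : set T -> set (set T)).
Variables (e : nat -> T -> T) (iota : T -> cantor) (x0 : T).
Hypothesis iota_inj : injective iota.
Hypothesis Ggraph : is_graph G.
Hypothesis Glf : locally_finite G.
Hypothesis eP : forall x y, connectedness G (x, y) <-> exists n, y = e n x.
Hypothesis hpoc : forall C : set T, components G C -> cut_pocset C (induced_graph G C) (HH C).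
Hypothesis hsep : forall C : set T, components G C -> finitely_separating C (HH C).
Hypothesis hdense : forall C : set T, components G C ->
  dense_towards_ends C (induced_graph G C) (HH C).
Variable o : T.

Local Notation C := (cls G o).
Local Notation g := (induced_graph G C).
Local Notation HS := (hsp HH C).
Local Notation bs := (base G iota x0 C).
Local Notation col := (colour G HH e iota x0 C).
Local Notation hsc := (hs G HH e).

Let Gsym : forall x y, G (x, y) -> G (y, x). Proof. by case: Ggraph. Qed.
Let gC : g `<=` C `*` C. Proof. exact: cls_graph_sub. Qed.
Let gsym x y : g (x, y) -> g (y, x). Proof. exact: cls_graph_sym. Qed.
Let gconn : connected_on g C. Proof. exact: cls_graph_connected. Qed.
Let glf : locally_finite g. Proof. exact: cls_graph_lf. Qed.
Let poc : cut_pocset C g (HH C). Proof. exact/hpoc/components_cls. Qed.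

Lemma hsp_cut H : HS H -> is_cut C g H.
Proof. by move=> [HHH _]; have [+ _ _] := poc; exact. Qed.

Lemma hsp_sub H : HS H -> H `<=` C.
Proof. by move=> /hsp_cut[[]]. Qed.

Lemma hsp_neq0 H : HS H -> H !=set0.
Proof. by move=> [_ [/eqP/set0P]]. Qed.

Lemma hsp_cpl H : HS H -> HS (C `\` H).
Proof.
move=> HH'; have HC := hsp_sub HH'; have [x Hx] := hsp_neq0 HH'.
case: HH' => HHH [H0 H1]; split; first by have [_ _ +] := poc; exact.
split=> E.
  apply: H1; apply/seteqP; split=> // y Cy; apply: contrapT => nHy.
  by suff : set0 y by []; rewrite -E.
by have : C x by [exact: HC]; rewrite -{1}E => -[].
Qed.

Lemma hsp_sep : finitely_separating C HS.
Proof.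
move=> x y Cx Cy; apply: sub_finite_set (hsep (components_cls G o) Cx Cy) => H [[HHH _] Hx nHy].
by split.
Qed.

Lemma hsp_proper (Y : set T) x m : Y `<=` C -> infinite_set Y -> C x ->
  exists2 y, Y y & exists s : seq (set T),
    [/\ uniq s, size s = m & forall H, H \in s -> [/\ HS H, H y & ~ H x]].
Proof.
move=> YC Yinf Cx.
have [y Yy [s [us sm sP]]] := proper_walling gC gsym glf (hdense (components_cls G o)) m YC Yinf Cx.
exists y => //; exists s; split=> // H /sP[HHH Hy nHx]; split=> //.
by split=> //; split=> E; [move: Hy; rewrite E|apply: nHx; rewrite E].
Qed.

Lemma finite_vbd H : HS H -> finite_set (vbd C g H).
Proof. by move=> /hsp_cut[[]]. Qed.

Lemma is_base_exists H : HS H -> exists y, is_base G iota C H y.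
Proof.
move=> HH'; have [_ [H0 H1]] := HH'.
have [y yb yle] := lex_le_min iota_inj (finite_vbd HH') (vbd_neq0 gC gsym gconn (hsp_sub HH') H0 H1).
by exists y.
Qed.

Lemma is_base_unique H y z : is_base G iota C H y -> is_base G iota C H z -> y = z.
Proof. by move=> [yb yle] [zb zle]; apply: lex_le_anti (yle _ zb) (zle _ yb). Qed.

Lemma baseP H : HS H -> is_base G iota C H (bs H).
Proof. by move=> /is_base_exists; exact: xgetPex. Qed.

Lemma base_in H : HS H -> C (bs H).
Proof. by move=> HH'; have [+ _] := baseP HH'; apply: vbd_sub; exact: hsp_sub. Qed.

Lemma base_cpl H : HS H -> bs (C `\` H) = bs H.
Proof.
move=> HH'; rewrite /base (_ : [set y | _] = [set y | is_base G iota C H y])//.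
by rewrite /is_base vbd_cpl//; exact: hsp_sub.
Qed.

Lemma ebd_inj H K : HS H -> HS K -> inward_ebd C g H = inward_ebd C g K -> H = K.
Proof.
move=> HH' HK E; have [_ [H0 H1]] := HH'; have [_ [K0 K1]] := HK.
apply/seteqP; split=> y.
  move/(cut_from_inward_ebd gC gsym gconn y (hsp_cut HH') H0 H1); rewrite E.
  by move/(cut_from_inward_ebd gC gsym gconn y (hsp_cut HK) K0 K1).
move/(cut_from_inward_ebd gC gsym gconn y (hsp_cut HK) K0 K1); rewrite -E.
by move/(cut_from_inward_ebd gC gsym gconn y (hsp_cut HH') H0 H1).
Qed.

Lemma ebd_finite H : HS H -> finite_set (inward_ebd C g H).
Proof.
move=> HH'; apply: (@sub_finite_set _ _ (vbd C g H `*` vbd C g H)).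
  by move=> [a b'] [_ [/= Ha Hb]]; split; [right|left].
by apply: finite_setX; exact: finite_vbd.
Qed.

Lemma hs_surj x H : C x -> HS H -> exists c, hsc c x = H.
Proof.
move=> Cx HH'; have CE := cls_eq Gsym Cx.
have /finite_seqP[s sE] := ebd_finite HH'.
have [c cE] : exists c, code_edges e c x = s.
  have : {subset s <= [pred p | `[< C p.1 /\ C p.2 >]]}.
    move=> p ps; apply/asboolP; have : inward_ebd C g H p by rewrite sE.
    by move=> [/gC[]].
  elim: (s) => [|[a b'] t IH] ts; first by exists [::].
  have [c ct] := IH (fun p pt => ts p (mem_behead (s := (a, b') :: t) pt)).
  have /asboolP[/= Ca Cb] := ts (a, b') (mem_head _ _).
  have /eP[i ia] : connectedness G (x, a) by apply/clsP; rewrite CE.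
  have /eP[j jb] : connectedness G (x, b') by apply/clsP; rewrite CE.
  by exists ((i, j) :: c); rewrite /code_edges /= -ia -jb; congr (_ :: _).
have [h1 h2] := @xgetI _ set0 [set H | HS H /\ inward_ebd C g H = [set` s]] H (conj HH' sE).
by exists c; rewrite /hs CE cE; apply: ebd_inj => //; rewrite h2.
Qed.

(** By definition [u] differs from the principal orientation at [x] on finitely many walls; [l]
    lists codes for them. *)
Lemma vt_surj x u : C x -> orientation C HS u -> exists l, vt G HH e l x = u.
Proof.
move=> Cx [uHS uc uup uf]; have CE := cls_eq Gsym Cx.
have /finite_seqP[s sE] := uf x Cx.
have sP H : H \in s <-> u H /\ ~ H x.
  by have /seteqP[sub sup] := sE; split; [exact: sup|exact: sub].
have [l lP] : exists l : seq (seq (nat * nat)), forall H, (exists2 c, c \in l & H = hsc c x) <-> H \in s.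
  have : forall H, H \in s -> HS H by move=> H /sP[/uHS].
  elim: (s) => [|K t IH] ts; first by exists [::] => H; split=> // -[].
  have [l lP] := IH (fun H Ht => ts H (mem_behead (s := K :: t) Ht)).
  have [c cK] := hs_surj Cx (ts K (mem_head _ _)).
  exists (c :: l) => H; split=> [[c']|].
    rewrite !inE => /predU1P[->|c'l] HE; first by rewrite HE cK eqxx.
    by apply/orP; right; apply/lP; exists c'.
  rewrite inE => /predU1P[->|/lP[c' c'l HE]]; first by exists c; rewrite ?mem_head.
  by exists c' => //; rewrite inE c'l orbT.
have cplK' H : HS H -> C `\` (C `\` H) = H by move=> /hsp_sub; exact: cplK.
have QE H : HS H -> (exists2 c, c \in l & H = hsc c x \/ H = C `\` hsc c x) <->
    H \in s \/ (C `\` H) \in s.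
  move=> HH'; split.
    case=> c cl [HE|HE]; [left|right]; apply/lP; exists c => //.
    rewrite HE cplK'//; have /lP/sP[/uHS//] : exists2 c', c' \in l & hsc c x = hsc c' x.
    by exists c.
  case=> /lP[c cl HE]; exists c => //; [by left|right].
  by rewrite -HE cplK'.
exists l; rewrite /vt CE; apply/seteqP; split=> H.
  case=> HH'; rewrite QE// => HQ; apply: contrapT => nuH; apply: HQ.
  have ucH : u (C `\` H) by apply/uc.
  split=> [Hx|[/sP[/nuH]//|/sP[_ nCHx]]]; first by right; apply/sP; split=> // -[].
  by apply: contrapT => nHx; apply: nCHx.
move=> uH; have HH' := uHS _ uH; split=> //; rewrite QE// => -[HQ QH].
have [Hx|nHx] := pselect (H x); last by apply/nHx/QH; left; apply/sP.
case: (HQ Hx) => /sP[]; first by move=> _ /(_ Hx).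
by rewrite uc.
Qed.

Lemma vt_dec_surj x u : C x -> orientation C HS u -> exists i, vt_dec G HH e i x = u.
Proof.
by move=> Cx /(vt_surj Cx)[l <-]; exists (pickle l); rewrite /vt_dec pickleK.
Qed.

Local Notation tagC := (wall_code G HH e iota x0 C).
Local Notation famC := (fam G HH e iota x0 C).

(** Take a code of [H] from its base point and enough digits to tell that point from the base points
    of all crossing walls. A crossing wall sharing these data has the same base point, so it is [H]
    or its complement, which do not cross [H]. *)
Lemma fam_exists H : HS H -> exists n, famC n H.
Proof.
move=> HH'; have Cb := base_in HH'; have [c cH] := hs_surj Cb HH'.
have fcr : finite_set [set K | HH C K /\ crossing C H K].
  apply: (finite_crossing gC gsym poc (hsep (components_cls G o))).
  by case: HH'.
have [N NP] := finite_isolated (iota (bs H)) (finite_image (fun K => iota (bs K)) fcr).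
pose p := ([seq iota (bs H) i | i <- seq.iota 0 N], c).
have tagE K : side_code G HH e iota x0 C (pickle p) K <-> agree N (iota (bs K)) (iota (bs H)) /\
    hsc c (bs K) = K.
  rewrite /side_code pickleK /= size_map size_iota.
  suff -> : agree N (iota (bs K)) (nth false [seq iota (bs H) i | i <- seq.iota 0 N]) <->
    agree N (iota (bs K)) (iota (bs H)) by [].
  by split=> h i iN; have := h i iN; rewrite (nth_map 0%N) ?size_iota// nth_iota.
have tag_eq K : side_code G HH e iota x0 C (pickle p) K -> bs K = bs H -> K = H.
  by move=> /tagE[_ KE] bK; rewrite -KE bK.
exists (pickle p); split; first by left; apply/tagE.
move=> K HK HK' [tK|tK]; have bK : bs K = bs H.
- by apply/iota_inj/NP; [exists K => //; split=> //; case: HK|have /tagE[] := tK].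
- case: HK' => _ [x [Hx nKx]] _ _; apply: nKx.
  by rewrite (tag_eq _ tK bK).
- apply/iota_inj/NP; first by exists K => //; split=> //; case: HK.
  by have /tagE[+ _] := tK; rewrite base_cpl.
- case: HK' => [[x [Hx Kx]] _ _ _]; move: Hx.
  by rewrite -(tag_eq _ tK) ?base_cpl// => -[].
Qed.

Lemma colourP H : HS H -> famC (col H) H /\ forall m, (m < col H)%N -> ~ famC m H.
Proof.
move=> HH'; have ex : exists n, `[< famC n H >].
  by have [n nH] := fam_exists HH'; exists n; exact/asboolP.
have [n /asboolP nH nmin] := ex_minnP ex.
suff ex' : exists n, famC n H /\ forall m, (m < n)%N -> ~ famC m H.
  exact: (@xgetPex _ 0%N [set n | famC n H /\ forall m, (m < n)%N -> ~ famC m H]).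
exists n; split=> // m mn mH; have := nmin m (asboolT mH).
by rewrite leqNgt mn.
Qed.

Lemma fam_cpl n H : HS H -> famC n H -> famC n (C `\` H).
Proof.
move=> HH' [tH cH]; have HC := hsp_sub HH'; split.
  by case: tH; [right; rewrite cplK|left].
move=> K HK HK'; apply: cH => //.
rewrite -(cplK HC); apply: crossing_cpl => //; last exact: hsp_sub.
Qed.

Lemma colour_cpl H : HS H -> col (C `\` H) = col H.
Proof.
move=> HH'; rewrite /colour; congr (xget _ _).
have famE n : famC n (C `\` H) <-> famC n H.
  split; last exact: fam_cpl.
  by move=> /(fam_cpl (hsp_cpl HH')); rewrite cplK//; exact: hsp_sub.
by apply/seteqP; split=> n [/famE fn fmin]; split=> // m mn /famE; exact: fmin.
Qed.

Lemma colour_nested H K : HS H -> HS K -> col H = col K -> ~ crossing C H K.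
Proof.
move=> HH' HK E HK'; have [[_ cH] _] := colourP HH'; have [[tK _] _] := colourP HK.
by apply: (cH K HK HK'); rewrite E.
Qed.

End ClassFacts.

(** * Definability *)

Section Definability.
Context {d : measure_display} {X : measurableType d}.
Variables (G : set (X * X)) (HH : set X -> set (set X)).
Variables (e : nat -> X -> X) (iota : X -> cantor) (x0 : X).
Hypothesis iota_inj : injective iota.
Hypothesis iota_bit : forall i, measurable [set x | iota x i].
Hypothesis Ggraph : is_graph G.
Hypothesis mG : measurable G.
Hypothesis Glf : locally_finite G.
Hypothesis me : forall n, measurable_fun setT (e n).
Hypothesis eP : forall x y, connectedness G (x, y) <-> exists n, y = e n x.
Hypothesis hpoc : forall C : set X, components G C -> cut_pocset C (induced_graph G C) (HH C).
Hypothesis hsep : forall C : set X, components G C -> finitely_separating C (HH C).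
Hypothesis hdense : forall C : set X, components G C ->
  dense_towards_ends C (induced_graph G C) (HH C).
Hypothesis hBorel : borel_finsubsets G (cut_codes G HH).

Local Notation cl := (cls G).
Local Notation HS x := (hsp HH (cls G x)).
Local Notation hsc := (hs G HH e).
Local Notation code := (seq (nat * nat)).

Let Gsym : forall x y, G (x, y) -> G (y, x). Proof. by case: Ggraph. Qed.

(* Functions of x naming a point, a half-space or a set of half-spaces of the
   class of x. *)
Definition point_name (a : X -> X) := measurable_fun setT a /\ forall x, cl x (a x).
Definition half_name (h : X -> set X) :=
  (forall m, mea (fun x => h x (e m x))) /\ forall x, h x `<=` cl x.
Definition family_name (v : X -> set (set X)) :=
  (forall c, mea (fun x => v x (hsc c x))) /\ forall x, v x `<=` HS x.

Lemma cls_enum x y : cl x y <-> exists n, y = e n x.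
Proof. by rewrite clsP. Qed.

Lemma point_name_enum n : point_name (e n).
Proof. by split=> // x; apply/cls_enum; exists n. Qed.

Lemma point_name_id : point_name id.
Proof. by split; [exact: measurable_id|move=> x; exact: cls_refl]. Qed.

Lemma point_name_cls a x : point_name a -> cl (a x) = cl x.
Proof. by move=> [_ ax]; exact: (cls_eq Gsym). Qed.

Lemma point_name_comp a a' : point_name a -> point_name a' -> point_name (a \o a').
Proof.
move=> [ma ca] [ma' ca']; split; first exact: measurableT_comp.
by move=> x; apply: (cls_trans (ca' x)); exact: ca.
Qed.

Lemma mea_eq_point a b : point_name a -> point_name b -> mea (fun x => a x = b x).
Proof.
move=> [ma _] [mb _]; apply: (@mea_ext _ _ (fun x => forall i, iota (a x) i <-> iota (b x) i)).
  move=> x; split=> [ab|->//]; apply/iota_inj/funext => i; by apply/idP/idP => /ab.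
by apply: mea_all => i; apply: mea_iff; apply: mea_comp (iota_bit i).
Qed.

Lemma mea_lex_le a b : point_name a -> point_name b -> mea (fun x => lex_le iota (a x) (b x)).
Proof.
move=> na nb; have [ma _] := na; have [mb _] := nb.
apply: mea_or; first exact: mea_eq_point.
apply: mea_ex => n.
apply: (@mea_ext _ _ (fun x => (forall i, (i < n)%N -> (iota (a x) i <-> iota (b x) i)) /\
    (~ iota (a x) n /\ iota (b x) n))).
  move=> x; split=> [[ab [/negP an bn]]|[ab /negP an bn]]; split=> //.
    by move=> i ni; apply/idP/idP => /ab; exact.
  by move=> i ni; rewrite ab.
apply: mea_and.
  apply: mea_all => i; apply: mea_imp; first exact: mea_cst.
  by apply: mea_iff; apply: mea_comp (iota_bit i).
apply: mea_and; last exact: mea_comp (iota_bit n).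
by apply: mea_not; exact: mea_comp (iota_bit n).
Qed.

Lemma mea_graph a b : point_name a -> point_name b -> mea (fun x => G (a x, b x)).
Proof.
move=> [ma _] [mb _].
have mab : measurable_fun setT (fun x => (a x, b x)) by exact: measurable_fun_pair.
by have := mab measurableT _ mG; rewrite setTI.
Qed.

Lemma mea_ex_point (P : X -> X -> Prop) : (forall m, mea (fun x => P x (e m x))) ->
  mea (fun x => exists y, cl x y /\ P x y).
Proof.
move=> mP; apply: (@mea_ext _ _ (fun x => exists m, P x (e m x))); last exact: mea_ex.
move=> x; split=> [[m Pm]|[y [/cls_enum[m ->] Pm]]]; last by exists m.
by exists (e m x); split=> //; apply/cls_enum; exists m.
Qed.

Lemma mea_all_point (P : X -> X -> Prop) : (forall m, mea (fun x => P x (e m x))) ->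
  mea (fun x => forall y, cl x y -> P x y).
Proof.
move=> mP; apply: (@mea_ext _ _ (fun x => forall m, P x (e m x))); last exact: mea_all.
move=> x; split=> [Pm y /cls_enum[m ->]//|Pm m]; apply: Pm.
by apply/cls_enum; exists m.
Qed.

Lemma mea_half h a : half_name h -> point_name a -> mea (fun x => h x (a x)).
Proof.
move=> [mh hC] na; apply: (@mea_ext _ _ (fun x => exists m, e m x = a x /\ h x (e m x))).
  move=> x; split=> [[m [<-]]//|hx]; have /cls_enum[m aE] := hC x _ hx.
  by exists m; rewrite -aE.
by apply: mea_ex => m; apply: mea_and => //; exact: mea_eq_point (point_name_enum m) na.
Qed.

Lemma mea_eq_half h k : half_name h -> half_name k -> mea (fun x => h x = k x).
Proof.
move=> [mh hC] [mk kC]; apply: (@mea_ext _ _ (fun x => forall m, h x (e m x) <-> k x (e m x))).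
  move=> x; split=> [hk|->//]; apply/seteqP; split=> y hy.
    by have /cls_enum[m yE] := hC x _ hy; move: hy; rewrite yE => /hk.
  by have /cls_enum[m yE] := kC x _ hy; move: hy; rewrite yE => /hk.
by apply: mea_all => m; exact: mea_iff.
Qed.

Lemma half_name_cpl h : half_name h -> half_name (fun x => cl x `\` h x).
Proof.
move=> [mh hC]; split=> [m|x y []//].
apply: (@mea_ext _ _ (fun x => ~ h x (e m x))); last exact: mea_not.
move=> x; split=> [nh|[]//]; split=> //.
by apply/cls_enum; exists m.
Qed.

Lemma half_name_cls : half_name (fun x => cl x).
Proof.
split=> [m|x]; last exact: subset_refl.
apply: (@mea_ext _ _ (fun=> True)); last exact: mea_cst.
by move=> x; split=> // _; apply/cls_enum; exists m.
Qed.

(** [cut_codes] ranges over all components, but a non-trivial cut has a boundary edge, whose ends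
    are of the form [e i x]; this forces the component of [x]. *)
Lemma hs_validE c x : HS x (hsc c x) <-> cut_codes G HH [set` code_edges e c x].
Proof.
split=> [[HHH [H0 H1]]|[C [H [[z0 _ oC] HHH H0 H1 E]]]].
  exists (cl x), (hsc c x); split=> //; first exact: components_cls.
  have [ex|nex] := pselect (exists H, HS x H /\
      inward_ebd (cl x) (induced_graph G (cl x)) H = [set` code_edges e c x]).
    by have [_ <-] := @xgetPex _ set0 _ ex.
  case: H0; apply: xgetPN => H; apply: contra_not nex => h.
  by exists H.
have oCE : C = cl z0 by rewrite -oC.
subst C; have HH' : hsp HH (cl z0) H by [].
have [[a b] abH] : inward_ebd (cl z0) (induced_graph G (cl z0)) H !=set0.
  have HC := hsp_sub hpoc HH'.
  have [a [b [gab Ha nHb]]] := cut_exit (cls_graph_connected Gsym (x:=z0)) HC H0 H1.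
  exists (b, a); exact: (inward_ebdI (@cls_graph_sub _ G (cl z0)) (@cls_graph_sym _ G Gsym (cl z0))).
have Ca : cl z0 a by case: abH => -[_ []].
have : (a, b) \in code_edges e c x by have := abH; rewrite -E.
case/mapP => -[i j] _ [ai bj].
have Cx : cl x a by apply/cls_enum; exists i.
have xz0 : cl x = cl z0 by rewrite -(cls_eq Gsym Cx) (cls_eq Gsym Ca).
have HHx : HS x H by rewrite xz0.
have Ex : inward_ebd (cl x) (induced_graph G (cl x)) H = [set` code_edges e c x].
  by rewrite xz0 E.
by have [] := @xgetI _ set0 [set H | HS x H /\
  inward_ebd (cl x) (induced_graph G (cl x)) H = [set` code_edges e c x]] H (conj HHx Ex).
Qed.

(** The Borel assumption on the family enters here, through tuples of the length of [c]. *)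
Lemma mea_valid c : mea (fun x => HS x (hsc c x)).
Proof.
apply: (@mea_ext _ _ (fun x => cut_codes G HH [set` code_edges e c x])).
  by move=> x; rewrite hs_validE.
have [_ /(_ (size c)) mt] := hBorel.
pose t x := map_tuple (fun p => (e p.1 x, e p.2 x)) (in_tuple c).
have mt' : measurable_fun setT t.
  apply/measurable_fun_tnthP => i; rewrite (_ : _ \o _ = fun x =>
    (e (tnth (in_tuple c) i).1 x, e (tnth (in_tuple c) i).2 x)).
    exact: measurable_fun_pair.
  by apply/funext => x; rewrite /= tnth_map.
by have := mt' measurableT _ mt; rewrite setTI.
Qed.

(** Coded edges point inwards, so the forbidden steps run from the second to the first endpoint. *)
Let cut_step (c : code) x u v := G (u, v) /\ forall p, p \in c -> ~ (v = e p.1 x /\ u = e p.2 x).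

(** [cut_from_inward_ebd] with the path spelled by indices, so that all quantifiers are
    countable. *)
Lemma hs_memE c x y : hsc c x y <-> HS x (hsc c x) /\
  exists p, p \in c /\ exists s : seq nat,
    path (fun u v => `[< cut_step c x u v >]) (e p.2 x) [seq e i x | i <- s] /\
    last (e p.2 x) [seq e i x | i <- s] = y.
Proof.
have CE := cut_from_inward_ebd (@cls_graph_sub _ G (cl x)) (@cls_graph_sym _ G Gsym (cl x))
  (@cls_graph_connected _ G Gsym x).
have [nv|v] := pselect (HS x (hsc c x)); last first.
  split=> [|[]//]; rewrite /hs; case: xgetP => [H _ [HH' E]|//].
  case: v; rewrite /hs; suff [] : HS x (xget set0 [set H | HS x H /\
    inward_ebd (cl x) (induced_graph G (cl x)) H = [set` code_edges e c x]]) by [].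
  by have [] := @xgetI _ set0 [set H | HS x H /\
    inward_ebd (cl x) (induced_graph G (cl x)) H = [set` code_edges e c x]] H (conj HH' E).
have eE : inward_ebd (cl x) (induced_graph G (cl x)) (hsc c x) = [set` code_edges e c x].
  rewrite {1}/hs; case: xgetP => [H _ []//|no].
  by have [_ []] := nv; rewrite /hs; case: xgetP => // H _ /no.
have [H0 H1] := nv.2; rewrite (CE _ y (hsp_cut hpoc nv) H0 H1) eE.
split=> [[p [s [pc ps sy]]]|[_ [p [pc [s [ps sy]]]]]].
  split=> //; have /mapP[[i j] ij pE] := pc; exists (i, j); split=> //.
  have Cj : cl x (e j x) by apply/cls_enum; exists j.
  have {pE} pE : p.2 = e j x by rewrite pE.
  rewrite -pE in Cj *; suff [t tE] : exists t, s = [seq e i x | i <- t].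
    exists t; rewrite -tE; split=> //; apply: sub_path ps => u w /asboolP[[uw _] nuw].
    apply/asboolP; split=> // q qc [we ue]; apply: nuw; rewrite we ue.
    by apply/mapP; exists q.
  elim: s (p.2) Cj ps {sy} => [|u s IH] w Cw /=; first by exists [::].
  move=> /andP[/asboolP[[_ [_ /= Cu]] _] /(IH u Cu)[t ->]].
  by have /cls_enum[k ->] := Cu; exists (k :: t).
exists (e p.1 x, e p.2 x), [seq e i x | i <- s]; split=> //=.
  by apply/mapP; exists p.
have : all (fun u => `[< cl x u >]) (e p.2 x :: [seq e i x | i <- s]).
  apply/allP => u; rewrite -[_ :: _]/[seq e i x | i <- p.2 :: s] => /mapP[i _ ->].
  by apply/asboolP/cls_enum; exists i.
move=> all_cl; apply: (sub_in_path _ all_cl ps) => u w /asboolP Cu /asboolP Cw /asboolP[uw nuw].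
apply/asboolP; split; first by split.
by move=> /mapP[q qc [we ue]]; apply: (nuw q qc).
Qed.

Lemma mea_path c m s a : point_name a ->
  mea (fun x => path (fun u v => `[< cut_step c x u v >]) (a x) [seq e i x | i <- s] /\
    last (a x) [seq e i x | i <- s] = e m x).
Proof.
elim: s a => [|i s IH] a na.
  apply: (@mea_ext _ _ (fun x => a x = e m x)); last exact: mea_eq_point (point_name_enum m).
  by move=> x; split=> [|[]].
apply: (@mea_ext _ _ (fun x => cut_step c x (a x) (e i x) /\
    (path (fun u v => `[< cut_step c x u v >]) (e i x) [seq e i x | i <- s] /\
     last (e i x) [seq e i x | i <- s] = e m x))).
  move=> x; split=> /=; first by case=> h [-> ->]; split=> //; rewrite andbT; exact/asboolP.
  by case=> /andP[/asboolP].
apply: mea_and; last exact: IH (point_name_enum i).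
apply: mea_and; first exact: mea_graph na (point_name_enum i).
apply: mea_all => p; apply: mea_imp; first exact: mea_cst.
by apply/mea_not/mea_and; apply: mea_eq_point => //; exact: point_name_enum.
Qed.

Lemma half_name_hs c : half_name (hsc c).
Proof.
split=> [m|x y xy]; last by have /hs_memE[v _] := xy; exact: (hsp_sub hpoc v).
apply: mea_ext; first by move=> x; exact: iff_sym (hs_memE c x (e m x)).
apply: mea_and; first exact: mea_valid.
apply: mea_ex => p; apply: mea_and; first exact: mea_cst.
by apply: mea_ex => s; exact: mea_path (point_name_enum p.2).
Qed.

Lemma half_surj x H : HS x H -> exists c, hsc c x = H.
Proof. exact: (hs_surj Ggraph eP hpoc (cls_refl G x)). Qed.

(** Every half-space of the class has a code, so the quantifier is countable. *)
Lemma mea_ex_half (P : X -> set X -> Prop) : (forall c, mea (fun x => P x (hsc c x))) ->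
  mea (fun x => exists H, HS x H /\ P x H).
Proof.
move=> mP; apply: (@mea_ext _ _ (fun x => exists c, HS x (hsc c x) /\ P x (hsc c x))).
  move=> x; split=> [[c h]|[H [HH' PH]]]; first by exists (hsc c x).
  by have [c cE] := half_surj HH'; exists c; rewrite cE.
by apply: mea_ex => c; apply: mea_and => //; exact: mea_valid.
Qed.

Lemma mea_all_half (P : X -> set X -> Prop) : (forall c, mea (fun x => P x (hsc c x))) ->
  mea (fun x => forall H, HS x H -> P x H).
Proof.
move=> mP; apply: (@mea_ext _ _ (fun x => forall c, HS x (hsc c x) -> P x (hsc c x))).
  move=> x; split=> [h H HH'|h c]; last exact: h.
  by have [c cE] := half_surj HH'; move: (h c); rewrite cE; exact.
by apply: mea_all => c; apply: mea_imp => //; exact: mea_valid.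
Qed.

Lemma mea_hsp h : half_name h -> mea (fun x => HS x (h x)).
Proof.
move=> nh; apply: (@mea_ext _ _ (fun x => exists H, HS x H /\ H = h x)).
  by move=> x; split=> [[H [+ <-]]//|hx]; exists (h x).
by apply: mea_ex_half => c; apply: mea_eq_half => //; exact: half_name_hs.
Qed.

Lemma half_name_comp h a : half_name h -> point_name a -> half_name (fun x => h (a x)).
Proof.
move=> [mh hC] na; split=> [m|x y /hC]; last by rewrite point_name_cls.
apply: (@mea_ext _ _ (fun x => exists j, e j (a x) = e m x /\ h (a x) (e j (a x)))).
  move=> x; split=> [[j [<-]]//|hx]; have /cls_enum[j jE] := hC _ _ hx.
  by exists j; rewrite -jE.
have [ma _] := na.
apply: mea_ex => j; apply: mea_and; last exact: (mea_comp ma (mh j)).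
apply: mea_eq_point (point_name_enum m).
exact: (point_name_comp (point_name_enum j) na).
Qed.

Lemma mea_family v h : family_name v -> half_name h -> mea (fun x => v x (h x)).
Proof.
move=> [mv vHS] nh; apply: (@mea_ext _ _ (fun x => exists c, hsc c x = h x /\ v x (hsc c x))).
  move=> x; split=> [[c [<-]]//|vh]; have [c cE] := half_surj (vHS _ _ vh).
  by exists c; rewrite cE.
by apply: mea_ex => c; apply: mea_and => //; apply: mea_eq_half => //; exact: half_name_hs.
Qed.

Lemma family_name_comp v a : family_name v -> point_name a -> family_name (fun x => v (a x)).
Proof.
move=> [mv vHS] na; split=> [c|x y /vHS]; last by rewrite point_name_cls.
apply: (@mea_ext _ _ (fun x => exists c', hsc c' (a x) = hsc c x /\ v (a x) (hsc c' (a x)))).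
  move=> x; split=> [[c' [<-]]//|vh]; have [c' cE] := half_surj (vHS _ _ vh).
  by exists c'; rewrite cE.
have [ma _] := na.
apply: mea_ex => c'; apply: mea_and; last exact: (mea_comp ma (mv c')).
by apply: mea_eq_half; [apply: half_name_comp na|]; exact: half_name_hs.
Qed.

Lemma family_name_vt l : family_name (vt G HH e l).
Proof.
split=> [c|x H []//]; apply: mea_and; first exact: mea_valid.
apply: mea_not; apply: mea_iff.
  exact: mea_half (half_name_hs c) point_name_id.
apply: (@mea_ext _ _ (fun x => exists c', c' \in l /\
    (hsc c x = hsc c' x \/ hsc c x = cl x `\` hsc c' x))).
  by move=> x; split=> [[c' [c'l h]]|[c' c'l h]]; exists c'.
apply: mea_ex => c'; apply: mea_and; first exact: mea_cst.
have nc := half_name_hs c; have nc' := half_name_hs c'.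
by apply: mea_or; apply: mea_eq_half => //; exact: half_name_cpl.
Qed.

Lemma family_name_dec i : family_name (vt_dec G HH e i).
Proof. exact: family_name_vt. Qed.

Lemma family_name_principal a : point_name a ->
  family_name (fun x => principal (HS x) (a x)).
Proof.
move=> na; split=> [c|x H []//]; apply: mea_and; first exact: mea_valid.
exact: mea_half (half_name_hs c) na.
Qed.

Lemma mea_eq_family v w : family_name v -> family_name w -> mea (fun x => v x = w x).
Proof.
move=> nv nw; have [_ vHS] := nv; have [_ wHS] := nw.
apply: (@mea_ext _ _ (fun x => forall H, HS x H -> (v x H <-> w x H))).
  move=> x; split=> [vw|->//]; apply/seteqP; split=> H h.
    by apply/vw => //; exact: vHS h.
  by apply/vw => //; exact: wHS h.
by apply: mea_all_half => c; apply: mea_iff; apply: mea_family => //; exact: half_name_hs.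
Qed.

Lemma mea_orientation v : family_name v -> mea (fun x => orientation (cl x) (HS x) (v x)).
Proof.
move=> nv; have [_ vHS] := nv; apply: (@mea_ext _ _ (fun x =>
    (forall H, HS x H -> (v x (cl x `\` H) <-> ~ v x H)) /\
    ((forall H, HS x H -> forall K, HS x K -> v x H ->
       (forall y, cl x y -> H y -> K y) -> v x K) /\
     (* Finiteness becomes the existence of a finite list of codes. *)
     (forall y, cl x y -> exists l : seq code, forall H, HS x H ->
       v x H /\ ~ H y -> exists c, c \in l /\ hsc c x = H)))).
  move=> x; split=> [[h1 [h2 h3]]|[_ h1 h2 h3]].
    split; [exact: vHS|exact: h1| |].
      move=> H K vH HK sHK; apply: (h2 H (vHS _ _ vH) K HK vH) => y _; exact: sHK.
    move=> y Cy; have [l lP] := h3 y Cy.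
    apply: (@sub_finite_set _ _ [set` [seq hsc c x | c <- l]]); last exact: finite_seq.
    move=> H [vH nHy]; have [c [cl' <-]] := lP H (vHS _ _ vH) (conj vH nHy).
    by apply/mapP; exists c.
  split=> //; split=> [H HH' K HK vH sHK|y Cy].
    by apply: (h2 H K vH HK) => y Hy; apply: sHK => //; exact: (hsp_sub hpoc HH').
  have /finite_seqP[s sE] := h3 y Cy.
  have sP H : H \in s <-> v x H /\ ~ H y.
    by have /seteqP[sub sup] := sE; split; [exact: sup|exact: sub].
  suff [l lP] : exists l : seq code, forall H, H \in s -> exists c, c \in l /\ hsc c x = H.
    by exists l => H _ /sP/lP.
  have : forall H, H \in s -> HS x H by move=> H /sP[/vHS].
  elim: (s) => [|K t IH] ts; first by exists [::].
  have [l lP] := IH (fun H Ht => ts H (mem_behead (s := K :: t) Ht)).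
  have [c cK] := half_surj (ts K (mem_head _ _)).
  exists (c :: l) => H; rewrite inE => /predU1P[->|/lP[c' [c'l c'E]]].
    by exists c; rewrite mem_head.
  by exists c'; rewrite inE c'l orbT.
apply: mea_and.
  apply: mea_all_half => c; have nc := half_name_hs c.
  apply: mea_iff; first by apply: mea_family => //; exact: half_name_cpl.
  by apply/mea_not; exact: mea_family.
apply: mea_and.
  apply: mea_all_half => c; apply: mea_all_half => c'.
  apply: mea_imp; first by apply: mea_family => //; exact: half_name_hs.
  apply: mea_imp; last by apply: mea_family => //; exact: half_name_hs.
  apply: mea_all_point => m; apply: mea_imp;
    apply: mea_half (point_name_enum m); exact: half_name_hs.
apply: mea_all_point => m; apply: mea_ex => l; apply: mea_all_half => c.
have nc := half_name_hs c; apply: mea_imp.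
  apply: mea_and; first exact: mea_family.
  by apply: mea_not; exact: mea_half (point_name_enum m).
apply: mea_ex => c'; apply: mea_and; first exact: mea_cst.
by apply: mea_eq_half => //; exact: half_name_hs.
Qed.

Lemma mea_ex_family (P : X -> set (set X) -> Prop) :
  (forall i, mea (fun x => P x (vt_dec G HH e i x))) ->
  mea (fun x => exists u, orientation (cl x) (HS x) u /\ P x u).
Proof.
move=> mP; apply: (@mea_ext _ _ (fun x => exists i,
    orientation (cl x) (HS x) (vt_dec G HH e i x) /\ P x (vt_dec G HH e i x))).
  move=> x; split=> [[i h]|[u [ou Pu]]]; first by exists (vt_dec G HH e i x).
  have [i iE] := vt_dec_surj Ggraph eP hpoc (cls_refl G x) ou.
  by exists i; rewrite iE.
apply: mea_ex => i; apply: mea_and => //; apply: mea_orientation.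
exact: family_name_dec.
Qed.

Lemma mea_flip v w h : family_name v -> family_name w -> half_name h ->
  mea (fun x => flip_edge (cl x) (HS x) (v x) (w x) (h x)).
Proof.
move=> nv nw nh; have [_ vHS] := nv; apply: (@mea_ext _ _ (fun x =>
    orientation (cl x) (HS x) (v x) /\ (orientation (cl x) (HS x) (w x) /\
    (HS x (h x) /\ forall K, HS x K -> (v x K /\ ~ w x K <-> K = h x))))).
  move=> x; split=> [[ov [ow [hh hK]]]|[ov ow E]].
    split=> //; apply/seteqP; split=> [K [vK nwK]|_ ->].
      by apply/(hK K); [exact: vHS vK|].
    exact/hK.
  have [vh nwh] : (v x `\` w x) (h x) by rewrite E.
  split=> //; split=> //; split; first exact: vHS vh.
  move=> K HK; split=> [vwK|->//]; suff : [set h x] K by [].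
  by rewrite -E.
apply: mea_and; first exact: mea_orientation.
apply: mea_and; first exact: mea_orientation.
apply: mea_and; first exact: mea_hsp.
apply: mea_all_half => c; have nc := half_name_hs c.
apply: mea_iff; last exact: mea_eq_half.
by apply: mea_and; [|apply: mea_not]; exact: mea_family.
Qed.

Lemma mea_vbd h a : half_name h -> point_name a ->
  mea (fun x => vbd (cl x) (induced_graph G (cl x)) (h x) (a x)).
Proof.
have inner k b : half_name k -> point_name b ->
    mea (fun x => inner_vbd (cl x) (induced_graph G (cl x)) (k x) (b x)).
  move=> nk nb; have [_ bC] := nb.
  apply: (@mea_ext _ _ (fun x => k x (b x) /\ exists y, cl x y /\
      (~ k x y /\ G (b x, y)))).
    move=> x; split=> [[kb [y [Cy [nky by_]]]]|[kb [y [Cy nky] [by_ _]]]].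
      by split=> //; exists y.
    by split=> //; exists y.
  apply: mea_and; first exact: mea_half.
  apply: mea_ex_point => m; have nm := point_name_enum m.
  by apply: mea_and; [apply: mea_not; exact: mea_half|exact: mea_graph].
move=> nh na; apply: mea_or; apply: inner => //; exact: half_name_cpl.
Qed.

Lemma mea_is_base h a : half_name h -> point_name a ->
  mea (fun x => is_base G iota (cl x) (h x) (a x)).
Proof.
move=> nh na; apply: mea_and; first exact: mea_vbd.
apply: (@mea_ext _ _ (fun x => forall z, cl x z ->
    vbd (cl x) (induced_graph G (cl x)) (h x) z -> lex_le iota (a x) z)).
  move=> x; split=> zP z; last by move=> _; exact: zP.
  move=> hz; apply: zP => //; apply: (vbd_sub _ hz).
  by case: nh.
apply: mea_all_point => m; have nm := point_name_enum m.
by apply: mea_imp; [exact: mea_vbd|exact: mea_lex_le].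
Qed.

Lemma mea_crossing h k : half_name h -> half_name k ->
  mea (fun x => crossing (cl x) (h x) (k x)).
Proof.
move=> nh nk; have [_ hC] := nh; have [_ kC] := nk.
apply: (@mea_ext _ _ (fun x => (exists y, cl x y /\ (h x y /\ k x y)) /\
   ((exists y, cl x y /\ (h x y /\ ~ k x y)) /\
   ((exists y, cl x y /\ (~ h x y /\ k x y)) /\
    exists y, cl x y /\ (~ h x y /\ ~ k x y))))).
  move=> x; split.
    move=> [[y1 [_ ?]] [[y2 [_ ?]] [[y3 [_ ?]] [y4 [? [? ?]]]]]].
    by split; [exists y1|exists y2|exists y3|exists y4].
  move=> [[y1 [h1 ?]] [y2 [h2 ?]] [y3 [? k3]] [y4 [? ? ?]]].
  split; first by exists y1; split=> //; exact: hC h1.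
  split; first by exists y2; split=> //; exact: hC h2.
  split; first by exists y3; split=> //; exact: kC k3.
  by exists y4.
do 3 (apply: mea_and; first by apply: mea_ex_point => m; have nm := point_name_enum m;
  apply: mea_and; try apply: mea_not; exact: mea_half).
apply: mea_ex_point => m; have nm := point_name_enum m.
by apply: mea_and; apply: mea_not; exact: mea_half.
Qed.

(** * Definability of the colouring, the median tree and the point tree *)

Local Notation bs x := (base G iota x0 (cls G x)).
Local Notation colr x := (colour G HH e iota x0 (cls G x)).
Local Notation dec := (vt_dec G HH e).
Local Notation hend x := (hyperplane_end (cls G x) (HS x) (colr x)).
Local Notation sel x := (selected (cls G x) (HS x) (colr x) (bs x) dec).
Local Notation tree x := (median_tree (cls G x) (HS x) (colr x) (bs x) dec).
Local Notation wlk x := (walk (cls G x) (HS x) (colr x) (bs x) dec).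
Local Notation wlkp x := (walk_to_point (cls G x) (HS x) (colr x) (bs x) dec).
Local Notation near x := (nearest (cls G x) (HS x) (colr x) (bs x) dec (lex_le iota)).
Local Notation ptree x := (point_tree (cls G x) (HS x) (colr x) (bs x) dec (lex_le iota)).

(** The value of [base] is replaced by the unique [is_base] point, quantified over the class; the
    first conjunct excludes the default [x0]. *)
Lemma mea_base (P : X -> X -> Prop) h : half_name h ->
  (forall m, mea (fun x => P x (e m x))) ->
  mea (fun x => HS x (h x) /\ P x (bs x (h x))).
Proof.
move=> nh mP; apply: (@mea_ext _ _ (fun x => HS x (h x) /\
    exists y, cl x y /\ (is_base G iota (cl x) (h x) y /\ P x y))).
  move=> x; split=> [[hh [y [Cy [yb Py]]]]|[hh Pb]]; split=> //.
    by rewrite (is_base_unique (baseP x0 iota_inj Ggraph hpoc hh) yb).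
  exists (bs x (h x)); split; first exact: base_in hh.
  by split=> //; exact: baseP hh.
apply: mea_and; first exact: mea_hsp.
apply: mea_ex_point => m; apply: mea_and => //.
exact: mea_is_base nh (point_name_enum m).
Qed.

Lemma mea_tag n h : half_name h ->
  mea (fun x => HS x (h x) /\ side_code G HH e iota x0 (cl x) n (h x)).
Proof.
move=> nh; rewrite /side_code; case: (odflt _ _) => s c.
apply: (@mea_base (fun x y => agree (size s) (iota y) (nth false s) /\ hsc c y = h x)) => // m.
have nm := point_name_enum m; have [mm _] := nm.
apply: mea_and; last by apply: mea_eq_half => //; apply: half_name_comp nm; exact: half_name_hs.
apply: (@mea_ext _ _ (fun x => forall i, (i < size s)%N -> (iota (e m x) i <-> nth false s i))).
  move=> x; split=> h' i si; last by rewrite h'.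
  by apply/idP/idP => /h'; exact.
apply: mea_all => i; apply: mea_imp; first exact: mea_cst.
by apply: mea_iff; [exact: (mea_comp mm (iota_bit i))|exact: mea_cst].
Qed.

Lemma mea_tagged n h : half_name h ->
  mea (fun x => HS x (h x) /\ wall_code G HH e iota x0 (cl x) n (h x)).
Proof.
move=> nh; apply: (@mea_ext _ _ (fun x =>
    (HS x (h x) /\ side_code G HH e iota x0 (cl x) n (h x)) \/
    (HS x (h x) /\ (HS x (cl x `\` h x) /\ side_code G HH e iota x0 (cl x) n (cl x `\` h x))))).
  move=> x; split=> [[[hh t]|[hh [_ t]]]|[hh [t|t]]].
  - by split=> //; left.
  - by split=> //; right.
  - by left.
  - by right; split=> //; split=> //; exact: hsp_cpl.
apply: mea_or; first exact: mea_tag.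
apply: mea_and; first exact: mea_hsp.
by apply: mea_tag; exact: half_name_cpl.
Qed.

Lemma mea_fam n h : half_name h ->
  mea (fun x => HS x (h x) /\ fam G HH e iota x0 (cl x) n (h x)).
Proof.
move=> nh; apply: (@mea_ext _ _ (fun x =>
    (HS x (h x) /\ wall_code G HH e iota x0 (cl x) n (h x)) /\
    forall K, HS x K -> crossing (cl x) (h x) K ->
      ~ (HS x K /\ wall_code G HH e iota x0 (cl x) n K))).
  move=> x; split=> [[[hh t] hK]|[hh [t hK]]].
    by split=> //; split=> // K HK cK tK; apply: (hK K).
  by split=> // K HK cK [_]; exact: hK.
apply: mea_and; first exact: mea_tagged.
apply: mea_all_half => c; have nc := half_name_hs c.
by apply: mea_imp; [exact: mea_crossing|apply: mea_not; exact: mea_tagged].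
Qed.

Lemma mea_colour n h : half_name h -> mea (fun x => HS x (h x) /\ colr x (h x) = n).
Proof.
move=> nh; apply: (@mea_ext _ _ (fun x =>
    (HS x (h x) /\ fam G HH e iota x0 (cl x) n (h x)) /\
    forall m, (m < n)%N -> ~ (HS x (h x) /\ fam G HH e iota x0 (cl x) m (h x)))).
  move=> x; split=> [[[hh fn] nmin]|[hh cn]].
    have [fc cmin] := colourP x0 iota_inj Ggraph eP hpoc hsep hh.
    split=> //; have [cn|nc|//] := ltngtP (colr x (h x)) n.
      by case: (nmin _ cn).
    by case: (cmin _ nc).
  have := colourP x0 iota_inj Ggraph eP hpoc hsep hh; rewrite cn => -[fc cmin].
  by split=> // m mn [_]; exact: cmin.
apply: mea_and; first exact: mea_fam.
apply: mea_all => m; apply: mea_imp; first exact: mea_cst.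
by apply: mea_not; exact: mea_fam.
Qed.

Lemma mea_below n v w : family_name v -> family_name w ->
  mea (fun x => col_below (colr x) n (v x) (w x)).
Proof.
move=> nv nw; have [_ vHS] := nv; apply: (@mea_ext _ _ (fun x => forall H, HS x H ->
    v x H /\ ~ w x H -> exists k, (k < n)%N /\ (HS x H /\ colr x H = k))).
  move=> x; split=> [h H vH nwH|h H HH' [vH nwH]].
    by have [k [kn [_ ck]]] := h H (vHS _ _ vH) (conj vH nwH); rewrite ck.
  by exists (colr x H); split=> //; exact: h.
apply: mea_all_half => c; have nc := half_name_hs c; apply: mea_imp.
  by apply: mea_and; [|apply: mea_not]; exact: mea_family.
by apply: mea_ex => k; apply: mea_and; [exact: mea_cst|exact: mea_colour].
Qed.

Lemma mea_hend h v u : half_name h -> family_name v -> family_name u ->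
  mea (fun x => HS x (h x) /\ hend x (h x) (v x) (u x)).
Proof.
move=> nh nv nu; apply: (@mea_ext _ _ (fun x =>
    (exists u', orientation (cl x) (HS x) u' /\
      (flip_edge (cl x) (HS x) (u x) u' (h x) \/
       flip_edge (cl x) (HS x) (u x) u' (cl x `\` h x))) /\
    exists n, (HS x (h x) /\ colr x (h x) = n) /\ col_below (colr x) n.+1 (u x) (v x))).
  move=> x; split=> [[[u' [_ e']] [n [[hh cn] b]]]|[hh [[u' e'] b]]].
    by split=> //; split; [exists u'|rewrite cn].
  split; last by exists (colr x (h x)).
  by exists u'; split=> //; case: e' => -[].
apply: mea_and.
  apply: mea_ex_family => i; have ni := family_name_dec i.
  by apply: mea_or; apply: mea_flip => //; exact: half_name_cpl.
by apply: mea_ex => n; apply: mea_and; [exact: mea_colour|exact: mea_below].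
Qed.

Lemma mea_sel h v u : half_name h -> family_name v -> family_name u ->
  mea (fun x => HS x (h x) /\ sel x (h x) (v x) (u x)).
Proof.
move=> nh nv nu; apply: (@mea_ext _ _ (fun x =>
    (HS x (h x) /\ hend x (h x) (v x) (u x)) /\
    (HS x (h x) /\ exists i, dec i (bs x (h x)) = u x /\ forall j, (j < i)%N ->
       ~ (HS x (h x) /\ hend x (h x) (v x) (dec j (bs x (h x))))))).
  move=> x; split=> [[[hh hu] [_ [i [iu imin]]]]|[hh [hu [i [iu imin]]]]].
    split=> //; split=> //; exists i; split=> // j ji hj; exact: (imin j ji).
  split=> //; split=> //; exists i; split=> // j ji [_]; exact: imin.
apply: mea_and; first exact: mea_hend.
apply: (@mea_base (fun x y => exists i, dec i y = u x /\ forall j, (j < i)%N ->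
       ~ (HS x (h x) /\ hend x (h x) (v x) (dec j y)))) => // m.
have nd i : family_name (fun x => dec i (e m x)).
  exact: family_name_comp (family_name_dec i) (point_name_enum m).
apply: mea_ex => i; apply: mea_and; first exact: mea_eq_family.
apply: mea_all => j; apply: mea_imp; first exact: mea_cst.
by apply: mea_not; exact: mea_hend.
Qed.

Lemma mea_tree v w : family_name v -> family_name w -> mea (fun x => tree x (v x) (w x)).
Proof.
move=> nv nw; have [_ vHS] := nv; apply: (@mea_ext _ _ (fun x => exists H, HS x H /\
    (flip_edge (cl x) (HS x) (v x) (w x) H /\
     ((HS x H /\ sel x H (v x) (v x)) \/ (HS x H /\ sel x H (v x) (w x)))))).
  move=> x; split=> [[H [HH' [e' s]]]|[H [e' s]]].
    by exists H; split=> //; case: s => -[_ s]; [left|right].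
  have HH' : HS x H.
    have [_ _ E] := e'; have [vH _] : (v x `\` w x) H by rewrite E.
    exact: vHS vH.
  by exists H; split=> //; split=> //; case: s => s; [left|right].
apply: mea_ex_half => c; have nc := half_name_hs c.
apply: mea_and; first exact: mea_flip.
by apply: mea_or; exact: mea_sel.
Qed.

Lemma mea_walk k v w : family_name v -> family_name w -> mea (fun x => wlk x k (v x) (w x)).
Proof.
move=> nv nw; elim: k v nv => [|k IH] v nv; first exact: mea_eq_family.
apply: (@mea_ext _ _ (fun x => exists u, orientation (cl x) (HS x) u /\
    (tree x (v x) u /\ wlk x k u (w x)))).
  move=> x; split=> [[u [_ h]]|[u [vu uw]]]; first by exists u.
  by exists u; split=> //; have [_ ] := tree_orient vu.
apply: mea_ex_family => i; have ni := family_name_dec i.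
by apply: mea_and; [exact: mea_tree|exact: IH].
Qed.

Lemma mea_walk_to_point k v a : family_name v -> point_name a ->
  mea (fun x => wlkp x k (v x) (a x)).
Proof.
move=> nv na; apply: mea_and.
  exact: mea_half half_name_cls na.
by apply: mea_walk => //; exact: family_name_principal.
Qed.

Lemma mea_nearest v a : family_name v -> point_name a -> mea (fun x => near x (v x) (a x)).
Proof.
move=> nv na; apply: mea_ex => k.
apply: (@mea_ext _ _ (fun x => wlkp x k (v x) (a x) /\
   ((forall y, cl x y -> forall j, (j < k)%N -> ~ wlkp x j (v x) y) /\
    forall y, cl x y -> wlkp x k (v x) y -> lex_le iota (a x) y))).
  move=> x; split=> [[h1 [h2 h3]]|[h1 h2 h3]].
    split=> // [j y jk yv|y yv]; first by apply: (h2 y _ j jk yv); case: yv.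
    by apply: h3 => //; case: yv.
  by split=> //; split=> [y _ j jk|y _]; [exact: h2|exact: h3].
apply: mea_and; first exact: mea_walk_to_point.
apply: mea_and.
  apply: mea_all_point => m; apply: mea_all => j; apply: mea_imp; first exact: mea_cst.
  by apply: mea_not; exact: mea_walk_to_point nv (point_name_enum m).
apply: mea_all_point => m; have nm := point_name_enum m.
by apply: mea_imp; [exact: mea_walk_to_point|exact: mea_lex_le].
Qed.

Lemma mea_point_tree a a' : point_name a -> point_name a' ->
  mea (fun x => ptree x (a x) (a' x)).
Proof.
move=> na na'; have np := family_name_principal na; have np' := family_name_principal na'.
apply: (@mea_ext _ _ (fun x => a x <> a' x /\
   (near x (principal (HS x) (a x)) (a' x) \/ (near x (principal (HS x) (a' x)) (a x) \/
    exists v, orientation (cl x) (HS x) v /\ exists w, orientation (cl x) (HS x) w /\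
      (tree x v w /\ (near x v (a x) /\ near x w (a' x))))))).
  move=> x; split=> [[aa' h]|[_ _ aa' h]].
    split=> //; [by case: na|by case: na'|].
    case: h => [h|[h|[v [_ [w [_ [vw [va wa']]]]]]]]; [exact: Or31|exact: Or32|apply: Or33].
    by exists v, w.
  split=> //; case: h => [h|h|[v [w [vw va wa']]]]; [by left|by right; left|right; right].
  have [ov ow] := tree_orient vw; exists v; split=> //.
  by exists w.
apply: mea_and; first by apply: mea_not; exact: mea_eq_point.
apply: mea_or; first exact: mea_nearest.
apply: mea_or; first exact: mea_nearest.
apply: mea_ex_family => i; have ni := family_name_dec i.
apply: mea_ex_family => j; have nj := family_name_dec j.
apply: mea_and; first exact: mea_tree.
by apply: mea_and; exact: mea_nearest.
Qed.

End Definability.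

(** * Treeability *)

(** The relation is covered by the graphs of the [e n], and equality with [e n] is tested bit by
    bit. *)
Lemma measurable_class_relation (d : measure_display) (X : measurableType d)
    (iota : X -> cantor) (e : nat -> X -> X) (P : X -> X -> Prop) :
  injective iota -> (forall i, measurable [set x | iota x i]) ->
  (forall n, measurable_fun setT (e n)) -> (forall n, mea (fun x => P x (e n x))) ->
  (forall x y, P x y -> exists n, y = e n x) -> measurable [set p : X * X | P p.1 p.2].
Proof.
move=> iota_inj iota_bit me mP Pe; apply: (@mea_ext _ (X * X)%type (fun p => exists n,
    (forall i, iota p.2 i <-> iota (e n p.1) i) /\ P p.1 (e n p.1))).
  move=> [x y] /=; split=> [[n [yE Pn]]|Pxy].
    suff -> : y = e n x by [].
    by apply/iota_inj/funext => i; apply/idP/idP => /yE.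
  by have [n yE] := Pe x y Pxy; exists n; rewrite -yE.
apply: mea_ex => n; apply: mea_and.
  apply: mea_all => i; apply: mea_iff.
    have ms : measurable_fun setT (@snd X X) by exact: measurable_snd.
    by have := ms measurableT _ (iota_bit i); rewrite setTI.
  have mef : measurable_fun setT (fun p : X * X => e n p.1).
    exact: measurableT_comp (me n) measurable_fst.
  by have := mef measurableT _ (iota_bit i); rewrite setTI.
have mf : measurable_fun setT (@fst X X) by exact: measurable_fst.
by have := mf measurableT _ (mP n); rewrite setTI.
Qed.

Theorem theorem4p2 (R : realType) (d : measure_display) (X : measurableType d)
    (hX : standard_borel R X)
    (E : set (X * X)) (hE : countable_borel_equivalence E)
    (G : set (X * X)) (hG : graphing E G) (hGfin : locally_finite G)
    (HH : set X -> set (set X))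
    (hpoc : forall C : set X, components G C ->
       cut_pocset C (induced_graph G C) (HH C))
    (hsep : forall C : set X, components G C ->
       finitely_separating C (HH C))
    (hdense : forall C : set X, components G C ->
       dense_towards_ends C (induced_graph G C) (HH C))
    (hBorel : borel_finsubsets G (cut_codes G HH)) :
  treeable E.
Proof.
(* The constructions need a default point, so the empty space is treated apart. *)
have [[x0 _]|noX] := pselect (exists x : X, True); last first.
  exists set0; split=> [|C [x]]; last by case: noX; exists x.
  split; [by split=> [x y []|x []]|exact: measurable0|].
  by apply/seteqP; split=> -[x]; case: noX; exists x.
have [iota [iota_inj iota_bit iota_range iota_pre]] := standard_borel_code x0 hX.
have [Ggraph mG GE] := hG; have [Gsym _] := Ggraph.
have [e [me eP]] := connectedness_enumeration iota_inj iota_bit iota_range iota_pre mG hGfin.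
(* The data depend on [x] only through its class, so any other point of the class may replace it
   ([Tcls]). *)
pose T x y := point_tree (cls G x) (hsp HH (cls G x)) (colour G HH e iota x0 (cls G x))
  (base G iota x0 (cls G x)) (vt_dec G HH e) (lex_le iota) x y.
have TC x y : T x y -> cls G x y by case.
have Tcls z x y : cls G z x -> T x y = point_tree (cls G z) (hsp HH (cls G z))
    (colour G HH e iota x0 (cls G z)) (base G iota x0 (cls G z)) (vt_dec G HH e)
    (lex_le iota) x y.
  by move=> zx; rewrite /T (cls_eq Gsym zx).
have hsub o H := @hsp_sub _ _ _ hpoc o H.
have hcol o H := @colour_cpl _ _ _ e iota x0 hpoc o H.
have hbase o H := @base_cpl _ _ _ iota x0 hpoc o H.
have Tsym x y : T x y -> T y x.
  move=> xy; rewrite (Tcls x); last exact: TC.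
  exact: (point_tree_sym (@hsub x) (@hcol x) (@hbase x) xy).
have Tside x y : T x y -> exists A : set X, [/\ A x, ~ A y &
    forall x' y', T x' y' -> A x' -> ~ A y' -> x' = x /\ y' = y].
  move=> xy; have [A [Ax nAy Axy]] := point_tree_side (@hsub x) (@hcol x) (@hbase x)
    (@lex_le_anti _ iota) xy.
  (* [T] is a single point tree only within a class; the intersection excludes edges of other
     classes. *)
  exists (A `&` cls G x); split; [by split=> //; exact: cls_refl|by case|].
  move=> x' y' xy' [Ax' Cx'] nAy'; apply: Axy => //; first by rewrite -Tcls.
  by move=> Ay'; apply: nAy'; split=> //; apply: cls_trans Cx' _; exact: TC.
have Tconn x y : cls G x y ->
    exists2 s, path (fun u v => `[< T u v >]) x s & last x s = y.
  move=> xy; have xx := cls_refl G x.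
  have [s xs sy] := point_tree_connected (@hsub x) (@hsp_neq0 _ G HH x)
    (@hsp_cpl _ G HH hpoc x) (@hsp_sep _ G HH hsep x)
    (@hsp_proper _ G HH Ggraph hGfin hdense x) (@hcol x)
    (@colour_nested _ G HH e iota x0 iota_inj Ggraph eP hpoc hsep x)
    (@base_in _ G HH iota x0 iota_inj Ggraph hpoc x)
    (@vt_dec_surj _ G HH e Ggraph eP hpoc x) (lex_le_min iota_inj) (@lex_le_anti _ iota) xx xy.
  exists s => //; apply: (sub_path _ xs) => u v /asboolP uv; apply/asboolP.
  by rewrite (Tcls x) //; case: uv.
pose TT : set (X * X) := [set p | T p.1 p.2].
have TTadj : adj TT = (fun u v => `[< T u v >]).
  by apply/funext => u; apply/funext => v; apply/idP/idP => /asboolP ?; apply/asboolP.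
have TTconn x y : connectedness TT (x, y) <-> cls G x y.
  split=> [[s /= xs <-]|/Tconn[s xs sy]]; last by exists s => //=; rewrite TTadj.
  elim: s x xs => [x _|z s IH x /= /andP[/asboolP xz zs]]; first exact: cls_refl.
  by apply: cls_trans (IH z zs); exact: TC.
have TTcls x : xsection (connectedness TT) x = cls G x.
  by apply/seteqP; split=> y; rewrite xsectionE /= => /TTconn.
have TTsym x y : TT (x, y) -> TT (y, x) by exact: Tsym.
exists TT; split; first split.
- by split=> // x [_ _].
- apply: (measurable_class_relation iota_inj iota_bit me) => [n|x y /TC].
    exact: (mea_point_tree x0 iota_inj iota_bit Ggraph mG me eP hpoc hsep hBorel
      (point_name_id G) (point_name_enum me eP n)).
  by move=> /clsP/eP.
- by rewrite -GE; apply/seteqP; split=> -[x y] => [/TTconn/clsP|/clsP/TTconn].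
move=> _ [x _ <-]; rewrite TTcls; split; first by exists x; exact: cls_refl.
  move=> [y z] [/= xy xz]; have [s ys sz] := Tconn y z (cls_trans (cls_sym Gsym xy) xz).
  exists s => //=; elim: s y xy ys {sz} => //= u s IH y xy /andP[/asboolP yu us].
  have xu : cls G x u by apply: cls_trans xy _; exact: TC.
  by rewrite IH// andbT; apply/asboolP.
apply: acyclic_of_sides => [y z [/Tside[A [Ay nAz Ayz]] _]|y z [/TTsym yz [/= Cy Cz]]].
  by exists A; split=> // y' z' [+ _]; exact: Ayz.
by split.
Qed.
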